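(* Let $W=UT_2$ and regard $UT_2$ as a $W$-algebra with left and right actions given by the usual left and right multiplication. Then $\mathrm{GId}(UT_2)$ is generated, as a $T_{UT_2}$-ideal of $UT_2\langle X\rangle$, by the polynomial $$[x_1,x_2]-[x_1,x_2,e_{22}].$$ Moreover, $gc_n(UT_2)=(n+2)2^{n-1}+2$ for every $n\ge 1$.
   Context: $F$ is a field of characteristic zero; all algebras are associative $F$-algebras. $UT_2$ is the algebra of $2\times 2$ upper triangular matrices over $F$, with matrix units $e_{ij}$ and basis $\{1=e_{11}+e_{22},\,e_{22},\,e_{12}\}$. Put $W=UT_2$. A $W$-algebra is an algebra $A$ that is a (unital) $W$-bimodule such that $w(a_1a_2)=(wa_1)a_2$, $(a_1a_2)w=a_1(a_2w)$, $(a_1w)a_2=a_1(wa_2)$ for all $w\in W$, $a_1,a_2\in A$. A homomorphism $\varphi$ of $W$-algebras is an algebra homomorphism with $\varphi(wav)=w\varphi(a)v$ for $w,v\in W$. A $W$-ideal is a two-sided ideal invariant under the bimodule action of $W$. Let $X=\{x_1,x_2,\dots\}$. Start from the algebra with $F$-basis the words $w_{0}x_{j_1}w_{1}x_{j_2}\cdots w_{n-1}x_{j_n}w_{n}$, $n\ge 1$, with $w_0,\dots,w_n\in\{1,e_{22},e_{12}\}$ ($x_i=1x_i=x_i1$), multiplied by juxtaposition and expanding the product of adjacent coefficients in the basis of $W$, with $W$ acting on both sides in the same manner. In $UT_2\langle X\rangle$ one moreover identifies with zero every linear polynomial $\sum_i\alpha_i w_i x v_i$ ($\alpha_i\in F$,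 $w_i,v_i\in W$) such that $\sum_i\alpha_i w_i a v_i=0$ for all $a\in W$, as well as its consequences; that is, $UT_2\langle X\rangle$ is the quotient by the $W$-ideal generated by all $\sum_i\alpha_i w_i f v_i$ with such coefficients and $f$ arbitrary. Equivalently, for all $f\in UT_2\langle X\rangle$: $e_{22}fe_{22}=e_{22}f$, $e_{22}fe_{12}=0$, $e_{12}fe_{22}=e_{12}f$, $e_{12}fe_{12}=0$. Its elements are called generalized polynomials. A $T_{UT_2}$-ideal is a $W$-ideal of $UT_2\langle X\rangle$ invariant under all $W$-algebra endomorphisms of $UT_2\langle X\rangle$ (i.e. under all substitutions of the variables by elements of $UT_2\langle X\rangle$). For a $W$-algebra $A$ in which $e_{22}ae_{22}=e_{22}a$, $e_{22}ae_{12}=0$, $e_{12}ae_{22}=e_{12}a$, $e_{12}ae_{12}=0$ hold for all $a\in A$, $\mathrm{GId}(A)$ is the set of $f(x_1,\dots,x_n)\in UT_2\langle X\rangle$ with $f(a_1,\dots,a_n)=0$ for all $a_i\in A$. $GP_n$ is the $F$-span of the elements $w_{0}x_{\sigma(1)}w_{1}\cdots w_{n-1}x_{\sigma(n)}w_{n}$, with $\sigma\in S_n$ and $w_i\in W$, and $gc_n(A)=\dim_F GP_n/(GP_n\cap \mathrm{GId}(A))$. Commutators: $[f,g]=fg-gf$, also when $g\in W$ (so $[f,e_{22}]=fe_{22}-e_{22}f$), and $[x_1,x_2,e_{22}]=[[x_1,x_2],e_{22}]$. *)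

(* Defs.v *)
From HB Require Import structures.
From mathcomp Require Import all_boot all_order all_algebra perm.
From mathcomp Require Import boolp classical_sets.
From mathcomp Require Import finmap monalg.

Set Implicit Arguments.
Unset Strict Implicit.
Unset Printing Implicit Defensive.

Import GRing.Theory.
Local Open Scope ring_scope.
Local Open Scope classical_set_scope.

(* The algebra UT_2 as a subalgebra of 'M_2. [is_trig_mx] means lower
   triangular, hence the transpose. *)

Definition is_upper (F : fieldType) : {pred 'M[F]_2} := fun A => is_trig_mx A^T.

Lemma is_upper_subalg (F : fieldType) : subalg_closed (@is_upper F).
Proof.
split; rewrite /is_upper ?unfold_in.
- by rewrite trmx1 scalar_mx_is_trig.
- move=> a A B; rewrite !unfold_in => /is_trig_mxP hA /is_trig_mxP hB.
  apply/is_trig_mxP => i j ij; rewrite !mxE; have := hA i j ij.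
  by have := hB i j ij; rewrite !mxE => -> ->; rewrite mulr0 addr0.
move=> A B; rewrite !unfold_in => /is_trig_mxP hA /is_trig_mxP hB.
apply/is_trig_mxP => i j ij; rewrite !mxE big1 // => k _.
have hA0 := hA k j; have hB0 := hB i k; rewrite !mxE in hA0 hB0.
case: (ltnP k j) => [/hA0->|jk]; first by rewrite mul0r.
by rewrite hB0 ?mulr0 // (leq_trans ij).
Qed.

HB.instance Definition _ (F : fieldType) :=
  GRing.isSubalgClosed.Build F 'M[F]_2 (@is_upper F) (@is_upper_subalg F).

Record UT2 (F : fieldType) :=
  MkUT2 { ut2_mx :> 'M[F]_2; _ : ut2_mx \in @is_upper F }.
HB.instance Definition _ (F : fieldType) := [isSub for @ut2_mx F].
HB.instance Definition _ (F : fieldType) := [Choice of UT2 F by <:].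
HB.instance Definition _ (F : fieldType) :=
  [SubChoice_isSubAlgebra of UT2 F by <:].

Section UT2Basis.
Variable F : fieldType.

Lemma delta_upper (i j : 'I_2) (ij : (i <= j)%N) :
  delta_mx i j \in @is_upper F.
Proof.
rewrite unfold_in; apply/is_trig_mxP => k l kl; rewrite !mxE.
by case: eqP => //= lk; case: eqP => //= kj; move: kl; rewrite lk kj ltnNge ij.
Qed.

Definition e22 : UT2 F := MkUT2 (@delta_upper 1 1 isT).
Definition e12 : UT2 F := MkUT2 (@delta_upper 0 1 isT).

(* The basis {1, e22, e12} of UT_2 and the coordinates in it. *)
Definition wbasis (i : 'I_3) : UT2 F := tnth [tuple 1; e22; e12] i.
Definition wcoord (w : UT2 F) (i : 'I_3) : F :=
  tnth [tuple w 0 0; w 1 1 - w 0 0; w 0 1] i.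

Lemma wcoordE (w : UT2 F) : w = \sum_i wcoord w i *: wbasis i.
Proof.
apply: val_inj; rewrite raddf_sum /=.
rewrite !big_ord_recl big_ord0 /wcoord /wbasis !(tnth_nth 0) /= addr0.
have := valP w; rewrite unfold_in => /is_trig_mxP/(_ 0 1 isT); rewrite mxE /= => w10.
apply/matrixP => i j; rewrite !mxE.
case: i => [[|[|//]] hi]; case: j => [[|[|//]] hj] /=;
  rewrite ?mulr0 ?mulr1 ?addr0 ?add0r ?mulr1n.
- by congr (_ _ _); apply: val_inj.
- by congr (_ _ _); apply: val_inj.
- by rewrite -[RHS]w10; congr (_ _ _); apply: val_inj.
by rewrite addrC subrK; congr (_ _ _); apply: val_inj.
Qed.

Lemma wcoord_linear i : linear (wcoord^~ i : UT2 F -> F^o).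
Proof.
move=> a u v; rewrite /wcoord !(tnth_nth 0).
case: i => [[|[|[|//]]] hi] /=; rewrite !mxE //=.
by rewrite /GRing.scale /= mulrBr opprD addrACA.
Qed.

End UT2Basis.

(* W-algebras for W = UT_2: associative, not necessarily unital, F-algebras
   with a unital W-bimodule structure compatible with the product. *)
HB.mixin Record isWAlgebra (F : fieldType) V of GRing.Lmodule F V := {
  wmul : V -> V -> V;
  lact : UT2 F -> V -> V;
  ract : V -> UT2 F -> V;
  wmul_linl : forall b, linear (wmul^~ b);
  wmul_linr : forall a, linear (wmul a);
  wmulA : associative wmul;
  lact_linl : forall a, linear (lact^~ a);
  lact_linr : forall w, linear (lact w);
  lact1 : forall a, lact 1 a = a;
  lactM : forall w v a, lact (w * v) a = lact w (lact v a);
  ract_linl : forall w, linear (ract^~ w);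
  ract_linr : forall a, linear (ract a);
  ract1 : forall a, ract a 1 = a;
  ractM : forall w v a, ract a (w * v) = ract (ract a w) v;
  lractA : forall w a v, ract (lact w a) v = lact w (ract a v);
  lact_wmul : forall w a b, lact w (wmul a b) = wmul (lact w a) b;
  ract_wmul : forall w a b, ract (wmul a b) w = wmul a (ract b w);
  wmul_rlact : forall w a b, wmul (ract a w) b = wmul a (lact w b)
}.

#[short(type="walgType")]
HB.structure Definition WAlgebra (F : fieldType) :=
  {V of GRing.Lmodule F V & isWAlgebra F V}.

Section LinearFacts.
Variables (F : fieldType) (U V : lmodType F) (f : U -> V) (fL : linear f).

Lemma linfD a b : f (a + b) = f a + f b.
Proof. by rewrite -[a]scale1r fL !scale1r. Qed.

Lemma linf0 : f 0 = 0.
Proof. by apply: (addrI (f 0)); rewrite -linfD !addr0. Qed.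

Lemma linfZ k a : f (k *: a) = k *: f a.
Proof. by rewrite -[k *: a]addr0 fL linf0 addr0. Qed.

Lemma linfB a b : f (a - b) = f a - f b.
Proof. by rewrite -scaleN1r linfD linfZ scaleN1r. Qed.

Lemma linf_sum (J : Type) (r : seq J) (P : pred J) (E : J -> U) :
  f (\sum_(i <- r | P i) E i) = \sum_(i <- r | P i) f (E i).
Proof. exact: (big_morph f linfD linf0). Qed.

End LinearFacts.

Section UT2WAlgebra.
Variable F : fieldType.
Implicit Types a b c : UT2 F.

Lemma ut2_mul_linl b : linear (fun a => a * b).
Proof. by move=> k u v; rewrite mulrDl scalerAl. Qed.

Lemma ut2_mul_linr a : linear (fun b => a * b).
Proof. by move=> k u v; rewrite mulrDr scalerAr. Qed.

HB.instance Definition _ := isWAlgebra.Build F (UT2 F)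
  ut2_mul_linl ut2_mul_linr (@mulrA _)
  ut2_mul_linl ut2_mul_linr (@mul1r _) (fun w v a => esym (mulrA w v a))
  ut2_mul_linl ut2_mul_linr (@mulr1 _) (fun w v a => mulrA a w v)
  (fun w a v => esym (mulrA w a v))
  (fun w a b => mulrA w a b)
  (fun w a b => esym (mulrA a b w))
  (fun w a b => esym (mulrA a w b)).

End UT2WAlgebra.

Section WAlgebraTheory.
Variables (F : fieldType) (A : walgType F).
Implicit Types (a b : A) (w v : UT2 F) (I S : set A).

Record is_wideal I : Prop := IsWIdeal {
  wideal0 : I 0;
  widealD : forall a b, I a -> I b -> I (a + b);
  widealZ : forall (k : F) a, I a -> I (k *: a);
  widealMl : forall a b, I b -> I (wmul a b);
  widealMr : forall a b, I a -> I (wmul a b);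
  widealL : forall w a, I a -> I (lact w a);
  widealR : forall w a, I a -> I (ract a w)
}.

Definition wideal_gen S : set A :=
  [set a | forall I, is_wideal I -> S `<=` I -> I a].

Lemma wideal_genP S : is_wideal (wideal_gen S).
Proof.
split.
- by move=> I II _; apply: wideal0.
- by move=> a b ha hb I II SI; apply: widealD => //; [apply: ha | apply: hb].
- by move=> k a ha I II SI; apply: widealZ => //; apply: ha.
- by move=> a b ha I II SI; apply: widealMl => //; apply: ha.
- by move=> a b ha I II SI; apply: widealMr => //; apply: ha.
- by move=> w a ha I II SI; apply: widealL => //; apply: ha.
by move=> w a ha I II SI; apply: widealR => //; apply: ha.
Qed.

Definition wcomm a b : A := wmul a b - wmul b a.
(* [a, w] for a coefficient w. *)
Definition wcommW a w : A := ract a w - lact w a.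

End WAlgebraTheory.

Record is_whom (F : fieldType) (A B : walgType F) (f : A -> B) : Prop := IsWHom {
  whom_linear : linear f;
  whomM : forall a b, f (wmul a b) = wmul (f a) (f b);
  whomLR : forall w a v, f (ract (lact w a) v) = ract (lact w (f a)) v
}.

Section WQuotient.
Variables (F : fieldType) (A : walgType F) (I : set A) (II : is_wideal I).
Local Open Scope quotient_scope.
Implicit Types (a b : A) (w v : UT2 F).

Definition wideal_pred of is_wideal I : {pred A} := fun a => `[< I a >].

Lemma wideal_zmod : zmod_closed (wideal_pred II).
Proof.
split; first by apply/asboolP; apply: wideal0.
move=> a b /asboolP ha /asboolP hb; apply/asboolP; apply: widealD => //.
by rewrite -scaleN1r; apply: widealZ.
Qed.
HB.instance Definition _ :=
  GRing.isZmodClosed.Build A (wideal_pred II) wideal_zmod.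

Definition wquot : Type := Quotient.quot (wideal_pred II).
HB.instance Definition _ := GRing.Zmodule.on wquot.
HB.instance Definition _ := EqQuotient.on wquot.
HB.instance Definition _ :=
  ZmodQuotient.on wquot.

Definition wpi (a : A) : wquot := \pi_wquot a.

Lemma wpiP a b : (wpi a = wpi b) <-> I (a - b).
Proof.
split=> [/eqP|h]; last apply/eqP.
  by rewrite -Quotient.idealrBE => /asboolP.
by rewrite -Quotient.idealrBE; apply/asboolP.
Qed.


Lemma wpiK (q : wquot) : wpi (repr q) = q. Proof. exact: reprK. Qed.

Lemma repr_wpi a : I (repr (wpi a) - a).
Proof. by apply/wpiP; rewrite wpiK. Qed.

Lemma wpiD a b : wpi (a + b) = wpi a + wpi b.
Proof. exact: Quotient.pi_add. Qed.

Definition wqscale (k : F) (q : wquot) : wquot := wpi (k *: repr q).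
Definition wqmul (p q : wquot) : wquot := wpi (wmul (repr p) (repr q)).
Definition wqlact w (q : wquot) : wquot := wpi (lact w (repr q)).
Definition wqract (q : wquot) w : wquot := wpi (ract (repr q) w).

Lemma wqscaleE k a : wqscale k (wpi a) = wpi (k *: a).
Proof.
by apply/wpiP; rewrite -scalerBr; apply: widealZ => //; apply: repr_wpi.
Qed.

Lemma wqmulE a b : wqmul (wpi a) (wpi b) = wpi (wmul a b).
Proof.
apply/wpiP; set a' := repr (wpi a); set b' := repr (wpi b).
have -> : wmul a' b' - wmul a b = wmul (a' - a) b' + wmul a (b' - b).
  rewrite (linfB (@wmul_linl _ _ _)) (linfB (@wmul_linr _ _ _)).
  by rewrite addrA subrK.
apply: widealD => //; first by apply: widealMr => //; apply: repr_wpi.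
by apply: widealMl => //; apply: repr_wpi.
Qed.

Lemma wqlactE w a : wqlact w (wpi a) = wpi (lact w a).
Proof.
apply/wpiP; rewrite -(linfB (@lact_linr _ _ _)).
by apply: widealL => //; apply: repr_wpi.
Qed.

Lemma wqractE w a : wqract (wpi a) w = wpi (ract a w).
Proof.
apply/wpiP; rewrite -(linfB (@ract_linl _ _ _)).
by apply: widealR => //; apply: repr_wpi.
Qed.

Lemma wquotW (P : wquot -> Prop) : (forall a, P (wpi a)) -> forall q, P q.
Proof. by move=> h q; rewrite -(wpiK q). Qed.

Fact wqscaleA k l q : wqscale k (wqscale l q) = wqscale (k * l) q.
Proof. by elim/wquotW: q => a; rewrite !wqscaleE scalerA. Qed.

Fact wqscale1 : left_id 1 wqscale.
Proof. by elim/wquotW => a; rewrite wqscaleE scale1r. Qed.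

Fact wqscaleDr : right_distributive wqscale +%R.
Proof.
move=> k; elim/wquotW => a; elim/wquotW => b.
by rewrite -wpiD !wqscaleE -wpiD scalerDr.
Qed.

Fact wqscaleDl q : {morph wqscale^~ q : k l / k + l}.
Proof. by elim/wquotW: q => a k l; rewrite !wqscaleE -wpiD scalerDl. Qed.

HB.instance Definition _ := GRing.Zmodule_isLmodule.Build F wquot
  wqscaleA wqscale1 wqscaleDr wqscaleDl.

Lemma wpi_linear : linear wpi.
Proof. by move=> k a b; rewrite wpiD -wqscaleE. Qed.

Fact wqmul_linl q : linear (wqmul^~ q).
Proof.
elim/wquotW: q => c k; elim/wquotW => a; elim/wquotW => b.
by rewrite -wpi_linear !wqmulE wmul_linl wpi_linear.
Qed.

Fact wqmul_linr q : linear (wqmul q).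
Proof.
elim/wquotW: q => c k; elim/wquotW => a; elim/wquotW => b.
by rewrite -wpi_linear !wqmulE wmul_linr wpi_linear.
Qed.

Fact wqmulA : associative wqmul.
Proof.
elim/wquotW => a; elim/wquotW => b; elim/wquotW => c.
by rewrite !wqmulE wmulA.
Qed.

Fact wqlact_linl q : linear (wqlact^~ q).
Proof.
by elim/wquotW: q => a k w v; rewrite !wqlactE lact_linl wpi_linear.
Qed.

Fact wqlact_linr w : linear (wqlact w).
Proof.
move=> k; elim/wquotW => a; elim/wquotW => b.
by rewrite -wpi_linear !wqlactE lact_linr wpi_linear.
Qed.

Fact wqlact1 q : wqlact 1 q = q.
Proof. by elim/wquotW: q => a; rewrite wqlactE lact1. Qed.

Fact wqlactM w v q : wqlact (w * v) q = wqlact w (wqlact v q).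
Proof. by elim/wquotW: q => a; rewrite !wqlactE lactM. Qed.

Fact wqract_linl w : linear (wqract^~ w).
Proof.
move=> k; elim/wquotW => a; elim/wquotW => b.
by rewrite -wpi_linear !wqractE ract_linl wpi_linear.
Qed.

Fact wqract_linr q : linear (wqract q).
Proof.
by elim/wquotW: q => a k w v; rewrite !wqractE ract_linr wpi_linear.
Qed.

Fact wqract1 q : wqract q 1 = q.
Proof. by elim/wquotW: q => a; rewrite wqractE ract1. Qed.

Fact wqractM w v q : wqract q (w * v) = wqract (wqract q w) v.
Proof. by elim/wquotW: q => a; rewrite !wqractE ractM. Qed.

Fact wqlractA w q v : wqract (wqlact w q) v = wqlact w (wqract q v).
Proof. by elim/wquotW: q => a; rewrite !(wqractE, wqlactE) lractA. Qed.

Fact wqlact_mul w p q : wqlact w (wqmul p q) = wqmul (wqlact w p) q.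
Proof.
elim/wquotW: p => a; elim/wquotW: q => b.
by rewrite !(wqmulE, wqlactE) lact_wmul.
Qed.

Fact wqract_mul w p q : wqract (wqmul p q) w = wqmul p (wqract q w).
Proof.
elim/wquotW: p => a; elim/wquotW: q => b.
by rewrite !(wqmulE, wqractE) ract_wmul.
Qed.

Fact wqmul_rlact w p q : wqmul (wqract p w) q = wqmul p (wqlact w q).
Proof.
elim/wquotW: p => a; elim/wquotW: q => b.
by rewrite wqlactE wqractE !wqmulE wmul_rlact.
Qed.

HB.instance Definition _ := isWAlgebra.Build F wquot
  wqmul_linl wqmul_linr wqmulA
  wqlact_linl wqlact_linr wqlact1 wqlactM
  wqract_linl wqract_linr wqract1 wqractM
  wqlractA wqlact_mul wqract_mul wqmul_rlact.

End WQuotient.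

Section LinearExtension.
Variables (F : fieldType) (K : choiceType) (V : lmodType F).
Implicit Types (h : K -> V) (g : {malg F[K]}).

Definition mlin h g : V := \sum_(k <- msupp g) g@_k *: h k.

Lemma mlinEw (d : {fset K}) h g : (msupp g `<=` d)%fset ->
  mlin h g = \sum_(k <- d) g@_k *: h k.
Proof.
move=> le; rewrite /mlin (big_fset_incl _ le) //= => k _ kN.
by rewrite mcoeff_outdom // scale0r.
Qed.

Lemma mlin_linear h : linear (mlin h).
Proof.
move=> k f g; pose d := (msupp f `|` msupp g `|` msupp (k *: f + g))%fset.
rewrite (@mlinEw d _ f) ?(@mlinEw d _ g) ?(@mlinEw d _ (k *: f + g)).
- rewrite scaler_sumr -big_split /=; apply: eq_bigr => i _.
  by rewrite mcoeffD mcoeffZ scalerDl scalerA.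
- exact: fsubsetUr.
- by rewrite /d -fsetUA fsetUCA fsubsetUl.
by rewrite /d -fsetUA fsubsetUl.
Qed.

Lemma mlin_linf k h1 h2 g :
  mlin (fun u => k *: h1 u + h2 u) g = k *: mlin h1 g + mlin h2 g.
Proof.
rewrite /mlin scaler_sumr -big_split; apply: eq_bigr => u _ /=.
by rewrite scalerDr !scalerA [k * _]mulrC.
Qed.

Lemma mlinU h u : mlin h << u >> = h u.
Proof.
rewrite (@mlinEw [fset u]%fset); last exact: msuppU_le.
by rewrite big_seq_fset1 mcoeffUU scale1r.
Qed.

Lemma eq_mlin h1 h2 g : h1 =1 h2 -> mlin h1 g = mlin h2 g.
Proof. by move=> e; apply: eq_bigr => u _; rewrite e. Qed.

Lemma mlin_uniq (f1 f2 : {malg F[K]} -> V) : linear f1 -> linear f2 ->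
  (forall u, f1 << u >> = f2 << u >>) -> f1 =1 f2.
Proof.
move=> l1 l2 e g.
have -> : g = \sum_(u <- msupp g) g@_u *: << u >>.
  rewrite {1}[g]monalgE; apply: eq_bigr => u _.
  by apply/malgP => v; rewrite mcoeffZ !mcoeffU -mulr_natr mulrnAr mulr1.
rewrite !linf_sum //; apply: eq_bigr => u _.
by rewrite !linfZ // e.
Qed.

End LinearExtension.

(* The algebra of words, before the linear identities are imposed. The triple
   (w0, (j1, [:: (w1, j2); ..; (wm, jn)]), wn), m = n - 1, encodes the word
   w0 x_j1 w1 x_j2 .. wm x_jn wn, the coefficients being given by their
   indices in [wbasis]. *)
Definition word : choiceType := ('I_3 * (nat * seq ('I_3 * nat)) * 'I_3)%type.

Definition wfree (F : fieldType) : Type := {malg F[word]}.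
HB.instance Definition _ (F : fieldType) := GRing.Lmodule.on (wfree F).

Section FreeWAlgebra.
Variable F : fieldType.
Implicit Types (u v : word) (w : UT2 F) (f g : wfree F).

Section Wext.
Variable V : lmodType F.
Implicit Type H : 'I_3 -> V.

(* Linear extension to UT_2 of a map defined on the basis. *)
Definition wext H w : V := \sum_e wcoord w e *: H e.

Lemma wext_linear H : linear (wext H).
Proof.
move=> k w v; rewrite /wext scaler_sumr -big_split /=.
by apply: eq_bigr => e _; rewrite wcoord_linear scalerDl scalerA.
Qed.

Lemma wextE (f : UT2 F -> V) w : linear f -> f w = wext (f \o @wbasis F) w.
Proof.
move=> fL; rewrite {1}[w]wcoordE linf_sum //.
by apply: eq_bigr => e _; rewrite linfZ.
Qed.

Lemma eq_wext H1 H2 w : H1 =1 H2 -> wext H1 w = wext H2 w.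
Proof. by move=> e; apply: eq_bigr => i _; rewrite e. Qed.

Lemma wext_wbasis H a : wext H (wbasis F a) = H a.
Proof.
rewrite /wext (bigD1 a) //= big1 => [|i ia]; rewrite /wcoord /wbasis.
  rewrite addr0 !(tnth_nth 0).
  by case: a => [[|[|[|//]]] ha] /=; rewrite !mxE /= ?subr0 scale1r;
    congr H; apply: val_inj.
rewrite !(tnth_nth 0); case: a ia => [[|[|[|//]]] ha];
  by case: i => [[|[|[|//]]] hi] //= _; rewrite !mxE /= ?subrr ?scale0r.
Qed.

Lemma wextC (H : 'I_3 -> 'I_3 -> V) (w1 w2 : UT2 F) :
  wext (fun e1 => wext (H e1) w2) w1 = wext (fun e2 => wext (H^~ e2) w1) w2.
Proof.
rewrite /wext (eq_bigr _ (fun e _ => scaler_sumr _ _ _ _)) exchange_big.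
apply: eq_bigr => e2 _ /=; rewrite scaler_sumr; apply: eq_bigr => e1 _.
by rewrite !scalerA mulrC.
Qed.

Lemma wext_comp H (f : UT2 F -> UT2 F) w : linear f ->
  wext (fun e => wext H (f (wbasis F e))) w = wext H (f w).
Proof.
move=> fL; rewrite [RHS](@wextE (wext H \o f)) // => k a b /=.
by rewrite fL wext_linear.
Qed.

End Wext.

Lemma linf_wext (U V : lmodType F) (f : U -> V) H w : linear f ->
  f (wext H w) = wext (fun e => f (H e)) w.
Proof.
by move=> fL; rewrite /wext linf_sum //; apply: eq_bigr => e _; rewrite linfZ.
Qed.

Definition word_mul u v : wfree F :=
  let: (a, (j, s), b) := u in
  let: (c, (k, t), d) := v in
  \sum_e wcoord (wbasis F b * wbasis F c) e *:
     << (a, (j, s ++ (e, k) :: t), d) : word >>.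

Definition word_lact w u : wfree F :=
  let: (a, p, b) := u in
  \sum_e wcoord (w * wbasis F a) e *: << (e, p, b) : word >>.

Definition word_ract u w : wfree F :=
  let: (a, p, b) := u in
  \sum_e wcoord (wbasis F b * w) e *: << (a, p, e) : word >>.

Definition fmul f g : wfree F := mlin (fun u => mlin (word_mul u) g) f.
Definition flact w f : wfree F := mlin (word_lact w) f.
Definition fract f w : wfree F := mlin (word_ract^~ w) f.

Fact fmul_linl g : linear (fmul^~ g).
Proof. exact: mlin_linear. Qed.

Fact fmul_linr f : linear (fmul f).
Proof.
move=> k g h; rewrite /fmul -mlin_linf; apply: eq_mlin => u.
by rewrite mlin_linear.
Qed.

Fact flact_linr w : linear (flact w).
Proof. exact: mlin_linear. Qed.

Fact fract_linl w : linear (fract^~ w).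
Proof. exact: mlin_linear. Qed.

Fact flact_linl f : linear (flact^~ f).
Proof.
move=> k w v; rewrite /flact -mlin_linf; apply: eq_mlin => -[[a p] b] /=.
rewrite mulrDl -scalerAl.
exact: (@wext_linear _ (fun e => << (e, p, b) : word >> : wfree F)).
Qed.

Fact fract_linr f : linear (fract f).
Proof.
move=> k w v; rewrite /fract -mlin_linf; apply: eq_mlin => -[[a p] b] /=.
rewrite mulrDr -scalerAr.
exact: (@wext_linear _ (fun e => << (a, p, e) : word >> : wfree F)).
Qed.

Lemma fmulU a j s b c k t d :
  fmul << (a, (j, s), b) : word >> << (c, (k, t), d) : word >> =
  wext (fun e => << (a, (j, s ++ (e, k) :: t), d) : word >> : wfree F)
       (wbasis F b * wbasis F c).
Proof. by rewrite /fmul !mlinU. Qed.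

Lemma flactU w a p b : flact w << (a, p, b) : word >> =
  wext (fun e => << (e, p, b) : word >> : wfree F) (w * wbasis F a).
Proof. by rewrite /flact mlinU. Qed.

Lemma fractU w a p b : fract << (a, p, b) : word >> w =
  wext (fun e => << (a, p, e) : word >> : wfree F) (wbasis F b * w).
Proof. by rewrite /fract mlinU. Qed.

Lemma lin_comp (U V T : lmodType F) (f : V -> T) (g : U -> V) :
  linear f -> linear g -> linear (fun x => f (g x)).
Proof. by move=> fL gL k x y; rewrite gL fL. Qed.

Let mull (w : UT2 F) : linear (fun z => w * z) := @ut2_mul_linr F w.
Let mulr (w : UT2 F) : linear (fun z => z * w) := @ut2_mul_linl F w.


Fact fmulA : associative fmul.
Proof.
move=> f g h; move: f.
apply: mlin_uniq; [exact: fmul_linl | apply: lin_comp; exact: fmul_linl |].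
move=> [[a1 [j s]] b1]; move: g; apply: mlin_uniq.
- exact: lin_comp (fmul_linr _) (fmul_linl _).
- exact: lin_comp (fmul_linl _) (fmul_linr _).
move=> [[a2 [k t]] b2]; move: h; apply: mlin_uniq.
- exact: lin_comp (fmul_linr _) (fmul_linr _).
- exact: fmul_linr.
move=> [[a3 [l r]] b3]; rewrite !fmulU.
rewrite (linf_wext _ _ (fmul_linr _)) (linf_wext _ _ (fmul_linl _)).
under [LHS]eq_wext => e do rewrite fmulU.
under [RHS]eq_wext => e do rewrite fmulU.
refine (etrans (wextC _ _ _) _); apply: eq_wext => e1; apply: eq_wext => e2.
by rewrite -catA.
Qed.

Fact flact1 f : flact 1 f = f.
Proof.
move: f; apply: mlin_uniq => [||[[a p] b]]; [exact: flact_linr|by []|].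
by rewrite flactU mul1r wext_wbasis.
Qed.

Fact fract1 f : fract f 1 = f.
Proof.
move: f; apply: mlin_uniq => [||[[a p] b]]; [exact: fract_linl|by []|].
by rewrite fractU mulr1 wext_wbasis.
Qed.

Fact flactM w (v : UT2 F) f : flact (w * v) f = flact w (flact v f).
Proof.
move: f; apply: mlin_uniq => [||[[a p] b]]; first exact: flact_linr.
  exact: lin_comp (flact_linr _) (flact_linr _).
rewrite !flactU (linf_wext _ _ (flact_linr _)).
under [RHS]eq_wext => e do rewrite flactU.
by rewrite (wext_comp _ _ (mull w)) mulrA.
Qed.

Fact fractM w (v : UT2 F) f : fract f (w * v) = fract (fract f w) v.
Proof.
move: f; apply: mlin_uniq => [||[[a p] b]]; first exact: fract_linl.
  exact: lin_comp (fract_linl _) (fract_linl _).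
rewrite !fractU (linf_wext _ _ (fract_linl _)).
under [RHS]eq_wext => e do rewrite fractU.
by rewrite (wext_comp _ _ (mulr v)) mulrA.
Qed.

Fact flractA w f (v : UT2 F) : fract (flact w f) v = flact w (fract f v).
Proof.
move: f; apply: mlin_uniq => [||[[a p] b]].
- exact: lin_comp (fract_linl _) (flact_linr _).
- exact: lin_comp (flact_linr _) (fract_linl _).
rewrite flactU fractU (linf_wext _ _ (fract_linl _)).
rewrite (linf_wext _ _ (flact_linr _)).
under [LHS]eq_wext => e do rewrite fractU.
under [RHS]eq_wext => e do rewrite flactU.
exact: (etrans (wextC _ _ _)).
Qed.

Fact flact_mul w f g : flact w (fmul f g) = fmul (flact w f) g.
Proof.
move: f; apply: mlin_uniq.
- exact: lin_comp (flact_linr _) (fmul_linl _).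
- exact: lin_comp (fmul_linl _) (flact_linr _).
move=> [[a [j s]] b]; move: g; apply: mlin_uniq.
- exact: lin_comp (flact_linr _) (fmul_linr _).
- exact: fmul_linr.
move=> [[c [k t]] d]; rewrite fmulU flactU (linf_wext _ _ (flact_linr _)).
rewrite (linf_wext _ _ (fmul_linl _)).
under [LHS]eq_wext => e do rewrite flactU.
under [RHS]eq_wext => e do rewrite fmulU.
exact: (etrans (wextC _ _ _)).
Qed.

Fact fract_mul w f g : fract (fmul f g) w = fmul f (fract g w).
Proof.
move: f; apply: mlin_uniq.
- exact: lin_comp (fract_linl _) (fmul_linl _).
- exact: fmul_linl.
move=> [[a [j s]] b]; move: g; apply: mlin_uniq.
- exact: lin_comp (fract_linl _) (fmul_linr _).
- exact: lin_comp (fmul_linr _) (fract_linl _).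
move=> [[c [k t]] d]; rewrite fmulU fractU (linf_wext _ _ (fract_linl _)).
rewrite (linf_wext _ _ (fmul_linr _)).
under [LHS]eq_wext => e do rewrite fractU.
under [RHS]eq_wext => e do rewrite fmulU.
exact: (etrans (wextC _ _ _)).
Qed.

Fact fmul_rlact w f g : fmul (fract f w) g = fmul f (flact w g).
Proof.
move: f; apply: mlin_uniq.
- exact: lin_comp (fmul_linl _) (fract_linl _).
- exact: fmul_linl.
move=> [[a [j s]] b]; move: g; apply: mlin_uniq.
- exact: fmul_linr.
- exact: lin_comp (fmul_linr _) (flact_linr _).
move=> [[c [k t]] d]; rewrite fractU flactU (linf_wext _ _ (fmul_linl _)).
rewrite (linf_wext _ _ (fmul_linr _)).
under [LHS]eq_wext => e do rewrite fmulU.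
under [RHS]eq_wext => e do rewrite fmulU.
by rewrite (wext_comp _ _ (mulr _)) (wext_comp _ _ (mull _)) mulrA.
Qed.

HB.instance Definition _ := isWAlgebra.Build F (wfree F)
  fmul_linl fmul_linr fmulA
  flact_linl flact_linr flact1 flactM
  fract_linl fract_linr fract1 fractM
  flractA flact_mul fract_mul fmul_rlact.

Definition fgen (i : nat) : wfree F := << (ord0, (i, [::]), ord0) : word >>.

End FreeWAlgebra.

(* The identities satisfied by the bimodule UT_2, in a W-algebra A. *)
Definition ut2_variety (F : fieldType) (A : walgType F) : Prop :=
  forall a : A,
    [/\ ract (lact (e22 F) a) (e22 F) = lact (e22 F) a,
        ract (lact (e22 F) a) (e12 F) = 0,
        ract (lact (e12 F) a) (e22 F) = lact (e12 F) a &
        ract (lact (e12 F) a) (e12 F) = 0].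

(* The linear polynomial \sum_i alpha_i w_i x v_i, given by the sequence of
   the triples (alpha_i, w_i, v_i), evaluated at a. *)
Definition linpoly (F : fieldType) (A : walgType F)
    (s : seq (F * UT2 F * UT2 F)) (a : A) : A :=
  \sum_(t <- s) t.1.1 *: ract (lact t.1.2 a) t.2.

Definition lin_rels (F : fieldType) : set (wfree F) :=
  [set g | exists s f, (forall a : UT2 F, linpoly s a = 0) /\ g = linpoly s f].
Arguments lin_rels : clear implicits.

(* The algebra UT_2<X> of generalized polynomials. *)
Definition gpoly (F : fieldType) : walgType F :=
  wquot (wideal_genP (lin_rels F)).

(* The variables are indexed from 0: [gX F i] is x_{i+1}. *)
Definition gX (F : fieldType) (i : nat) : gpoly F := wpi _ (fgen F i).

Section Evaluation.
Variables (F : fieldType) (A : walgType F).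
Implicit Type a : nat -> A.

Definition word_eval a (u : word) : A :=
  let: (b, (j, s), c) := u in
  ract (foldl (fun p t => wmul p (lact (wbasis F t.1) (a t.2)))
              (lact (wbasis F b) (a j)) s)
       (wbasis F c).

Definition feval a : wfree F -> A := mlin (word_eval a).

(* The value f(a_1, a_2, ..); by [geval_wpi] below it does not depend on the
   representative of f, provided A satisfies the defining identities. *)
Definition geval a (f : gpoly F) : A := feval a (repr f).

Definition GId : set (gpoly F) := [set f | forall a, geval a f = 0].

End Evaluation.

Definition is_Tideal (F : fieldType) (I : set (gpoly F)) : Prop :=
  is_wideal I /\
  forall phi : gpoly F -> gpoly F, is_whom phi -> forall f, I f -> I (phi f).

Definition Tideal_gen (F : fieldType) (S : set (gpoly F)) : set (gpoly F) :=
  [set f | forall I, is_Tideal I -> S `<=` I -> I f].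

Section Codimension.
Variables (F : fieldType) (V : lmodType F).
Implicit Types P Q S : set V.

Definition lspan S : set V :=
  [set v | exists m (c : 'I_m -> F) (u : 'I_m -> V),
    (forall i, S (u i)) /\ v = \sum_i c i *: u i].

(* The quotient P / Q of the subspaces Q <= P has a basis of d elements,
   given by representatives. *)
Definition quot_basis P Q (d : nat) : Prop :=
  exists b : 'I_d -> V,
    [/\ forall i, P (b i),
        forall c : 'I_d -> F, Q (\sum_i c i *: b i) -> forall i, c i = 0 &
        forall v, P v -> exists c : 'I_d -> F, Q (v - \sum_i c i *: b i)].

(* The dimension of P / Q (see [quot_basis_uniq]); 0 if it is infinite. *)
Definition quot_dim P Q : nat := xget 0%N [set d | quot_basis P Q d].

End Codimension.

(* w0 a1 w1 a2 w2 .. an wn for s = [:: (a1, w1); ..; (an, wn)], n >= 1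
   (and 0 when s is empty). *)
Definition gmonom (F : fieldType) (A : walgType F) (w0 : UT2 F)
    (s : seq (A * UT2 F)) : A :=
  if s is (a1, w1) :: s' then
    foldl (fun p t => ract (wmul p t.1) t.2) (ract (lact w0 a1) w1) s'
  else 0.

Definition GP (F : fieldType) (n : nat) : set (gpoly F) :=
  lspan [set f | exists (sigma : 'S_n) (w : 'I_n.+1 -> UT2 F),
    f = gmonom (w ord0)
          [seq (gX F (sigma i), w (lift ord0 i)) | i <- enum 'I_n]].
Arguments GP : clear implicits.

Definition gc (F : fieldType) (A : walgType F) (n : nat) : nat :=
  quot_dim (GP F n) (GP F n `&` GId A).

Lemma ut2_in_variety (F : fieldType) : ut2_variety (UT2 F).
Proof.
move=> a; have := valP a; rewrite unfold_in => /is_trig_mxP/(_ 0 1 isT).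
rewrite mxE /= => a10.
split; apply: val_inj; apply/matrixP => i j.
all: rewrite !mxE ?big_ord_recl ?big_ord0 !mxE.
all: rewrite ?big_ord_recl ?big_ord0 ?mxE.
all: case: i => [[|[|//]] hi]; case: j => [[|[|//]] hj] //=.
all: rewrite ?mul0r ?mulr0 ?mul1r ?mulr1 ?add0r ?addr0 //.
all: by [rewrite -a10; congr (a _ _); apply: val_inj
  | rewrite -[LHS]a10; congr (a _ _); apply: val_inj
  | congr (a _ _); apply: val_inj].
Qed.

Section Consistency.
Variables (F : fieldType) (A : walgType F).

Definition lin_coef (s : seq (F * UT2 F * UT2 F)) b c : F :=
  \sum_(t <- s) t.1.1 * wcoord t.1.2 b * wcoord t.2 c.

Lemma linpolyE (B : walgType F) s (a : B) : linpoly s a =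
  \sum_b \sum_c lin_coef s b c *: ract (lact (wbasis F b) a) (wbasis F c).
Proof.
transitivity (\sum_b \sum_c \sum_(t <- s)
  (t.1.1 * wcoord t.1.2 b * wcoord t.2 c)
    *: ract (lact (wbasis F b) a) (wbasis F c)); last first.
  apply: eq_bigr => b _; apply: eq_bigr => c _.
  by rewrite /lin_coef scaler_suml.
rewrite /linpoly.
under [RHS]eq_bigr => b _ do rewrite exchange_big /=.
rewrite exchange_big /=; apply: eq_bigr => -[[k w] v] _ /=.
rewrite {1}[w]wcoordE {1}[v]wcoordE.
rewrite (linf_sum (@lact_linl _ _ a)) (linf_sum (@ract_linl _ _ _)).
rewrite scaler_sumr; apply: eq_bigr => b _.
rewrite (linf_sum (@ract_linr _ _ _)) scaler_sumr; apply: eq_bigr => c _.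
rewrite (linfZ (@lact_linl _ _ a)) (linfZ (@ract_linl _ _ _)).
by rewrite (linfZ (@ract_linr _ _ _)) !scalerA mulrA.
Qed.

Lemma linpoly_variety (B : walgType F) s (a : B) : ut2_variety B ->
  let C (i j : 'I_3) := lin_coef s i j in
  linpoly s a = C 0 0 *: a + C 0 1 *: ract a (e22 F)
    + C 0 2%:R *: ract a (e12 F)
    + (C 1 0 + C 1 1) *: lact (e22 F) a
    + (C 2%:R 0 + C 2%:R 1) *: lact (e12 F) a.
Proof.
move=> /(_ a) [h1 h2 h3 h4] C.
have o1 : lift ord0 ord0 = 1 :> 'I_3 by apply: val_inj.
have o2 : lift ord0 (lift ord0 ord0) = 2%:R :> 'I_3 by apply: val_inj.
rewrite linpolyE !big_ord_recl !big_ord0 !o2 !o1 /= {o1 o2}.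
rewrite /wbasis !(tnth_nth 0) /= !lact1 !ract1 h1 h2 h3 h4.
by rewrite -!/(C _ _) !scaler0 !addr0 !scalerDl !addrA.
Qed.

Lemma linpoly_eq0 s : ut2_variety A -> (forall a : UT2 F, linpoly s a = 0) ->
  forall a : A, linpoly s a = 0.
Proof.
move=> hA h a; rewrite (linpoly_variety s a hA) /=.
set C := lin_coef s.
have E (b : UT2 F) i j :
    (linpoly s b : 'M_2) i j = (C 0 0 *: b + C 0 1 *: (b * e22 F)
    + C 0 2%:R *: (b * e12 F) + (C 1 0 + C 1 1) *: (e22 F * b)
    + (C 2%:R 0 + C 2%:R 1) *: (e12 F * b)) i j.
  by rewrite (linpoly_variety s b (@ut2_in_variety F)).
have E1 := E 1; have E2 := E (e12 F); have E3 := E (e22 F).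
have H1 := E1 0 0; have H2 := E2 0 1; have H3 := E1 1 1.
have H4 := E3 0 1; have H5 := E1 0 1.
move: H1 H2 H3 H4 H5; rewrite !h /= !(mxE, big_ord_recl, big_ord0) /=.
rewrite !(mul0r, mulr0, mul1r, mulr1, add0r, addr0).
move=> <-; rewrite !add0r => <-; rewrite !add0r => <- <-.
rewrite !(add0r, addr0) => <-.
by rewrite !scale0r !addr0.
Qed.

Section Feval.
Variable a : nat -> A.

Let G := foldl (fun p (t : 'I_3 * nat) => wmul p (lact (wbasis F t.1) (a t.2))).

Let G_linear s : linear (fun x : A => G x s).
Proof.
elim: s => [|t s IH] k x y //=.
by rewrite -IH wmul_linl.
Qed.

Let G_lact w x s : lact w (G x s) = G (lact w x) s.
Proof. by elim: s x => [|t s IH] x //=; rewrite IH lact_wmul. Qed.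

Let G_wmul x y s : wmul x (G y s) = G (wmul x y) s.
Proof. by elim: s y => [|t s IH] y //=; rewrite IH wmulA. Qed.

Lemma feval_linear : linear (feval a).
Proof. exact: mlin_linear. Qed.

Let fevalU u : feval a << u >> = word_eval a u.
Proof. exact: mlinU. Qed.

Lemma feval_wmul f g : feval a (wmul f g) = wmul (feval a f) (feval a g).
Proof.
move: f; apply: mlin_uniq.
- exact: lin_comp feval_linear (@wmul_linl _ _ _).
- exact: lin_comp (@wmul_linl _ _ _) feval_linear.
move=> [[b [j s]] c]; move: g; apply: mlin_uniq.
- exact: lin_comp feval_linear (@wmul_linr _ _ _).
- exact: lin_comp (@wmul_linr _ _ _) feval_linear.
move=> [[b' [k t]] d]; rewrite !fevalU /= [X in feval _ X]fmulU (linf_wext _ _ feval_linear).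
rewrite -/G -ract_wmul wmul_rlact G_lact -lactM.
pose H w := ract (wmul (G (lact (wbasis F b) (a j)) s) (G (lact w (a k)) t))
  (wbasis F d).
have HL : linear H.
  move=> x v w; rewrite /H lact_linl G_linear wmul_linr.
  by rewrite ract_linl.
rewrite -/(H _) (wextE _ HL); apply: eq_wext => e.
by rewrite fevalU /= -/G /G foldl_cat /= -/G -G_wmul.
Qed.

Lemma feval_lact w f : feval a (lact w f) = lact w (feval a f).
Proof.
move: f; apply: mlin_uniq.
- exact: lin_comp feval_linear (@lact_linr _ _ _).
- exact: lin_comp (@lact_linr _ _ _) feval_linear.
move=> [[b [j s]] c]; rewrite fevalU /= [X in feval _ X]flactU (linf_wext _ _ feval_linear).
rewrite -/G -lractA G_lact -lactM.
pose H v := ract (G (lact v (a j)) s) (wbasis F c).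
have HL : linear H.
  by move=> x v w'; rewrite /H lact_linl G_linear ract_linl.
by rewrite -/(H _) (wextE _ HL); apply: eq_wext => e; rewrite fevalU.
Qed.

Lemma feval_ract f w : feval a (ract f w) = ract (feval a f) w.
Proof.
move: f; apply: mlin_uniq.
- exact: lin_comp feval_linear (@ract_linl _ _ _).
- exact: lin_comp (@ract_linl _ _ _) feval_linear.
move=> [[b [j s]] c]; rewrite fevalU /= [X in feval _ X]fractU (linf_wext _ _ feval_linear).
rewrite -ractM (wextE _ (@ract_linr _ _ _)).
by apply: eq_wext => e; rewrite fevalU.
Qed.

Lemma feval_gen i : feval a (fgen F i) = a i.
Proof. by rewrite fevalU /= /wbasis (tnth_nth 0) lact1 ract1. Qed.

Hypothesis hA : ut2_variety A.

Lemma geval_wpi f : geval a (wpi _ f : gpoly F) = feval a f.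
Proof.
apply/eqP; rewrite -subr_eq0 -(linfB feval_linear); apply/eqP.
have /(_ [set g | feval a g = 0]) := repr_wpi (wideal_genP (lin_rels F)) f.
apply.
  split => /=; first exact: linf0 feval_linear.
  - by move=> x y x0 y0; rewrite (linfD feval_linear) x0 y0 addr0.
  - by move=> k x x0; rewrite (linfZ feval_linear) x0 scaler0.
  - by move=> x y y0; rewrite feval_wmul y0 (linf0 (@wmul_linr _ _ _)).
  - by move=> x y x0; rewrite feval_wmul x0 (linf0 (@wmul_linl _ _ _)).
  - by move=> w x x0; rewrite feval_lact x0 (linf0 (@lact_linr _ _ _)).
  by move=> w x x0; rewrite feval_ract x0 (linf0 (@ract_linl _ _ _)).
move=> _ [s [g [hs ->]]] /=; rewrite /linpoly (linf_sum feval_linear).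
rewrite -[RHS](linpoly_eq0 hA hs (feval a g)); apply: eq_bigr => t _.
by rewrite (linfZ feval_linear) feval_ract feval_lact.
Qed.

Lemma geval_gX i : geval a (gX F i) = a i.
Proof. by rewrite geval_wpi feval_gen. Qed.

Lemma geval_whom : is_whom (geval a : gpoly F -> A).
Proof.
split.
- move=> k; elim/wquotW => x; elim/wquotW => y.
  by rewrite -wpi_linear !geval_wpi feval_linear.
- elim/wquotW => x; elim/wquotW => y.
  by rewrite [wmul _ _]wqmulE !geval_wpi feval_wmul.
move=> w; elim/wquotW => x v.
by rewrite [lact _ _]wqlactE [ract _ _]wqractE !geval_wpi feval_ract feval_lact.
Qed.

End Feval.
End Consistency.

Lemma linpoly1 (F : fieldType) (A : walgType F) w v (a : A) :
  linpoly [:: (1, w, v)] a = ract (lact w a) v.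
Proof. by rewrite /linpoly big_seq1 scale1r. Qed.

Lemma linpoly2 (F : fieldType) (A : walgType F) w v (a : A) :
  linpoly [:: (1, w, v); (-1, w, 1)] a = ract (lact w a) v - lact w a.
Proof.
by rewrite /linpoly !big_cons big_nil /= addr0 scale1r scaleN1r ract1.
Qed.

Lemma gpoly_variety (F : fieldType) : ut2_variety (gpoly F).
Proof.
elim/wquotW => f.
have rel (s : seq (F * UT2 F * UT2 F)) : (forall a : UT2 F, linpoly s a = 0) ->
    linpoly s (wpi (wideal_genP (lin_rels F)) f) = 0.
  move=> hs.
  have -> : linpoly s (wpi (wideal_genP (lin_rels F)) f) = wpi _ (linpoly s f).
    rewrite /linpoly (linf_sum (@wpi_linear _ _ _ _)); apply: eq_bigr => t _.
    rewrite (linfZ (@wpi_linear _ _ _ _)).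
    by rewrite [lact _ _]wqlactE [ract _ _]wqractE.
  rewrite -(linf0 (@wpi_linear _ _ _ (wideal_genP (lin_rels F)))).
  by apply/wpiP; rewrite subr0 => I _; apply; exists s, f.
have V := @ut2_in_variety F.
split.
- have h (a : UT2 F) : linpoly [:: (1, e22 F, e22 F); (-1, e22 F, 1)] a = 0.
    by rewrite linpoly2; have [-> _ _ _] := V a; rewrite subrr.
  by have := rel _ h; rewrite linpoly2 => /subr0_eq.
- have h (a : UT2 F) : linpoly [:: (1, e22 F, e12 F)] a = 0.
    by rewrite linpoly1; have [_ -> _ _] := V a.
  by have := rel _ h; rewrite linpoly1.
- have h (a : UT2 F) : linpoly [:: (1, e12 F, e22 F); (-1, e12 F, 1)] a = 0.
    by rewrite linpoly2; have [_ _ -> _] := V a; rewrite subrr.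
  by have := rel _ h; rewrite linpoly2 => /subr0_eq.
have h (a : UT2 F) : linpoly [:: (1, e12 F, e12 F)] a = 0.
  by rewrite linpoly1; have [_ _ _ ->] := V a.
by have := rel _ h; rewrite linpoly1.
Qed.

Lemma quot_basis_uniq (F : fieldType) (V : lmodType F) (P Q : set V) m n :
  Q 0 -> (forall (k : F) u v, Q u -> Q v -> Q (k *: u + v)) ->
  quot_basis P Q m -> quot_basis P Q n -> m = n.
Proof.
move=> Q0 Qlin.
suff le m1 m2 : quot_basis P Q m1 -> quot_basis P Q m2 -> (m1 <= m2)%N.
  by move=> h1 h2; apply/eqP; rewrite eqn_leq !le.
move=> [b [Pb ib sb]] [b' [Pb' _ sb']].
have [M hM] : exists M : 'I_m1 -> 'I_m2 -> F,
    forall i, Q (b i - \sum_j M i j *: b' j).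
  by have := fun i => sb' _ (Pb i); move/choice => [M hM]; exists M.
pose A := \matrix_(i, j) M i j.
suff /eqP <- : row_free A by apply: rank_leq_col.
rewrite -kermx_eq0; apply/rowV0P => v /sub_kermxP vA.
apply/rowP => i; rewrite mxE; apply: (ib (v 0)); clear i.
have QD u1 u2 : Q u1 -> Q u2 -> Q (u1 + u2).
  by move=> ? ?; rewrite -[u1]scale1r; apply: Qlin.
have -> : \sum_i v 0 i *: b i = \sum_i v 0 i *: (b i - \sum_j M i j *: b' j).
  rewrite [RHS](eq_bigr _ (fun i _ => scalerBr _ _ _)) sumrB.
  rewrite [X in _ - X](eq_bigr _ (fun i _ => scaler_sumr _ _ _ _)) exchange_big.
  rewrite [X in _ - X]big1 ?subr0 // => j _ /=.
  under eq_bigr => i _ do rewrite scalerA.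
  rewrite -scaler_suml (_ : \sum_i _ = 0) ?scale0r //.
  transitivity ((v *m A) 0 j); last by rewrite vA mxE.
  by rewrite mxE; apply: eq_bigr => i _; rewrite mxE.
by elim/big_ind: _ => // i _; rewrite -[_ *: _]addr0; apply: Qlin.
Qed.

(* Main.v *)
(** Write elements of UT_2 by matrix units E_pq, p <= q in {1, 2}. Every
generalized polynomial is a combination of words E x E x .. E in matrix units,
and such a word is nonzero only if its sequence of indices is nondecreasing, so
that the index jumps at most once, at a coefficient or at a variable. On UT_2
the word takes the value (product of entries x_l(p, q)) E_rc. The polynomial
amounts to the two laws [f, g] e_11 = 0 and e_22 [f, g] = 0: modulo these,
variables between two E_11 commute, and so do variables between two E_22, hence
two words with the same r, c and the same multiset of entries coincide. Words
with distinct data take linearly independent values, because distinct monomials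
are distinct characters (Dedekind). So the kernel of the evaluation is exactly
the ideal generated by these laws, and counting multilinear data gives
2 + 2^n + n 2^(n-1). *)

Require Import Defs.
From mathcomp Require Import all_boot all_order all_algebra perm.
From mathcomp Require Import boolp classical_sets.
From mathcomp Require Import monalg.

Set Implicit Arguments.
Unset Strict Implicit.

Import GRing.Theory.
Local Open Scope ring_scope.
Local Open Scope classical_set_scope.

(** * Matrix units of UT_2 *)

Definition ix (b : bool) : 'I_2 := if b then 1 else 0.

(** Indices are booleans, so that p <= q is [p ==> q]. The unit E_21, absent from UT_2, is set to 0
    to keep the family total. *)
Definition munit (F : fieldType) (r p : bool) : UT2 F :=
  match r, p with
  | false, false => 1 - e22 F
  | false, true => e12 F
  | true, true => e22 F
  | true, false => 0
  end.
Arguments munit : simpl never.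

Section MatrixUnits.
Variable F : fieldType.
Local Notation U := (munit F).

Lemma munit_mx r p : ut2_mx (U r p) = (r ==> p)%:R *: delta_mx (ix r) (ix p).
Proof.
case: r; case: p; rewrite /munit /= ?scale1r ?scale0r //.
apply/matrixP => i j; rewrite !mxE.
by case: i => [[|[|//]] hi]; case: j => [[|[|//]] hj] /=;
  rewrite ?subr0 ?subrr.
Qed.

Lemma munit_mulr r p : U r p * U p p = U r p.
Proof.
apply: val_inj; rewrite /= !munit_mx implybb scale1r -scalerAl.
by rewrite -mulmxE mul_delta_mx.
Qed.

Lemma munit_mull r p : U r r * U r p = U r p.
Proof.
apply: val_inj; rewrite /= !munit_mx implybb scale1r -scalerAr.
by rewrite -mulmxE mul_delta_mx.
Qed.

Lemma munit_sandwich r p q c (a : UT2 F) : r ==> p -> p ==> q -> q ==> c ->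
  U r p * a * U q c = a (ix p) (ix q) *: U r c.
Proof.
move=> rp pq qc; apply: val_inj; rewrite /= !munit_mx rp qc.
have -> : r ==> c by move: rp pq qc; case: r; case: p; case: q; case: c.
rewrite !scale1r; apply/matrixP => i j; rewrite !mxE (bigD1 (ix q)) //=.
rewrite big1 => [|k /negPf kq]; last by rewrite !mxE kq mulr0.
rewrite addr0 !mxE (bigD1 (ix p)) //= big1 => [|k /negPf kp].
  by rewrite !mxE !eqxx /= andbT addr0 mulrC; case: eqP; case: eqP;
    rewrite /= ?(mul1r, mul0r, mulr0, mulr1).
by rewrite mxE kp andbF mul0r.
Qed.

Lemma munit_expand (w : UT2 F) :
  w = w (ix false) (ix false) *: U false false
    + w (ix false) (ix true) *: U false true
    + w (ix true) (ix true) *: U true true.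
Proof.
apply: val_inj; set a := w _ _; set b := w _ _; set c := w _ _.
change (ut2_mx w = a *: ut2_mx (U false false) + b *: ut2_mx (U false true)
                   + c *: ut2_mx (U true true)).
rewrite !munit_mx !scale1r {}/a {}/b {}/c /=.
have := valP w; rewrite unfold_in => /is_trig_mxP/(_ 0 1 isT).
rewrite mxE /= => w10; apply/matrixP => i j; rewrite !mxE.
case: i => [[|[|//]] hi]; case: j => [[|[|//]] hj] /=;
  rewrite ?mulr0 ?mulr1 ?addr0 ?add0r.
- by congr (w _ _); apply: val_inj.
- by congr (w _ _); apply: val_inj.
- by rewrite -[RHS]w10; congr (w _ _); apply: val_inj.
by congr (w _ _); apply: val_inj.
Qed.

End MatrixUnits.

Record is_subspace (F : fieldType) (V : lmodType F) (P : set V) : Prop :=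
IsSubspace {
  subspace0 : P 0;
  subspaceP : forall (k : F) a b, P a -> P b -> P (k *: a + b)
}.

(** * Words in matrix units and their span *)

Section GeneralizedMonomials.
Variables (F : fieldType) (A : walgType F).
Implicit Types (a b : A) (w v : UT2 F).
Local Notation U := (munit F).

(** [gmonom] accumulates from the left; inductions along a word need its first letter peeled off
    instead. *)
Lemma gmonom_cons w0 w1 a1 t s :
  gmonom w0 ((a1, w1) :: t :: s) = wmul (lact w0 a1) (gmonom w1 (t :: s)).
Proof.
case: t => a2 w2 /=; rewrite wmul_rlact ract_wmul.
elim: s (ract _ w2) => [|[a3 w3] s IH] b //=.
by rewrite -wmulA ract_wmul IH.
Qed.

(* The word [E_(r p1) x_l1 E_(q1 p2) x_l2 .. x_ln E_(qn c)], where E is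
   [munit], for the sequence of the letters [(l1, (p1, q1)) .. (ln, (pn, qn))].
   In UT_2 the letter [(l, (p, q))] contributes the entry (p, q) of x_l. *)
Fixpoint tword (x : nat -> A) (r : bool) (L : seq (nat * (bool * bool)))
    (c : bool) : A :=
  match L with
  | [::] => 0
  | [:: (l, (p, q))] => ract (lact (U r p) (x l)) (U q c)
  | (l, (p, q)) :: L' => wmul (lact (U r p) (x l)) (tword x q L' c)
  end.

Lemma tword_cons x r l p q t L c : tword x r ((l, (p, q)) :: t :: L) c =
  wmul (lact (U r p) (x l)) (tword x q (t :: L) c).
Proof. by []. Qed.

Lemma tword_gmonom x r L c : L <> [::] ->
  exists w0 ws, size ws = size L /\
    tword x r L c = gmonom w0 (zip [seq x t.1 | t <- L] ws).
Proof.
elim: L r => [//|[l [p q]] [|t L] IH] r _.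
  by exists (U r p), [:: U q c].
have [//|w0 [[|w ws] [// szw E]]] := IH q.
exists (U r p), (w0 :: w :: ws); split; first by case: szw => /= ->.
by rewrite tword_cons E; apply: esym; apply: gmonom_cons.
Qed.

Section Span.
Variables (x : nat -> A) (P : set A) (subP : is_subspace P).

Let linP (f : UT2 F -> A) w : linear f ->
  (forall r p, P (f (U r p))) -> P (f w).
Proof.
move=> fL Pf; rewrite [w]munit_expand !(linfD fL) !(linfZ fL).
rewrite -[_ *: f (U true true)]addr0 -addrA.
by do 3!(apply: (subspaceP subP); first exact: Pf); apply: subspace0.
Qed.

(** The monomial is linear in each coefficient, so the coefficients can be expanded in matrix units
    one after the other. *)
Lemma gmonom_span ls w0 ws : size ws = size ls -> ls <> [::] ->
  (forall r L c, [seq t.1 | t <- L] = ls -> P (tword x r L c)) ->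
  P (gmonom w0 (zip (map x ls) ws)).
Proof.
move=> szw lsn Pw.
(* The linear map [f] absorbs, as left factors, the letters already expanded. *)
suff gen (f : A -> A) : linear f ->
    (forall r L c, [seq t.1 | t <- L] = ls -> P (f (tword x r L c))) ->
    P (f (gmonom w0 (zip (map x ls) ws))) by exact: (gen id).
elim: ls lsn ws w0 f szw {Pw} => [//|l [|l' ls] IH] _ [//|w1 ws] w0 f szw fL Pf.
  case: ws szw => //= _.
  apply: (@linP (fun w => f (ract (lact w (x l)) w1)) w0) => [|r p].
    by move=> k u v; rewrite lact_linl ract_linl fL.
  apply: (@linP (fun w => f (ract (lact (U r p) (x l)) w)) w1) => [|q c].
    by move=> k u v; rewrite ract_linr fL.
  by have := Pf r [:: (l, (p, q))] c erefl.
case: ws szw => [//|w2 ws] szw.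
rewrite [zip _ _]/= gmonom_cons.
apply: (@linP (fun w => f (wmul (lact w (x l)) _)) w0) => [|r p].
  by move=> k u v; rewrite lact_linl wmul_linl fL.
have ls'n : l' :: ls <> [::] by [].
have := IH ls'n (w2 :: ws) w1 (fun y => f (wmul (lact (U r p) (x l)) y)).
apply=> [|k u v|q L c Ls]; first exact: succn_inj szw.
  by rewrite wmul_linr fL.
case: L Ls => [//|t L] Ls.
by rewrite -tword_cons; apply: Pf; rewrite -Ls.
Qed.

Lemma feval_span g : (forall r L c, L <> [::] -> P (tword x r L c)) ->
  P (feval x g).
Proof.
move=> Pw; rewrite /feval /mlin.
apply: (big_rec (fun y => P y)) => [|u y _ Py]; first exact: subspace0.
apply: subspaceP => //.
case: u => [[b [j t]] c] /=.
(* [word_eval] attaches each inner coefficient to the next variable, [gmonom] to the previous one;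
   [wmul_rlact] converts between them. *)
suff [w [ws [szw ->]]] : exists w ws, size ws = size t /\
    ract (foldl (fun p t => wmul p (lact (wbasis F t.1) (x t.2)))
                (lact (wbasis F b) (x j)) t) (wbasis F c)
    = gmonom (wbasis F b) (zip (map x (j :: [seq e.2 | e <- t])) (w :: ws)).
  apply: gmonom_span => [|//|r [|t' L] c' // _]; last exact: Pw.
  by rewrite /= szw size_map.
rewrite /=; elim: t (lact _ _) => [|[e k] t IHt] p /=.
  by exists (wbasis F c), [::].
have [w [ws [szw ->]]] := IHt (wmul p (lact (wbasis F e) (x k))).
exists (wbasis F e), (w :: ws); split; first by rewrite /= szw.
by rewrite /= -wmul_rlact.
Qed.

End Span.

(** Excludes every descent of the index from 2 to 1, at a unit or at a variable; a single descent
    kills the word. *)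
Fixpoint tvalid (r : bool) (L : seq (nat * (bool * bool))) (c : bool) : bool :=
  if L is (_, (p, q)) :: L' then [&& r ==> p, p ==> q & tvalid q L' c]
  else r ==> c.

Section Variety.
Hypothesis varA : ut2_variety A.
Variable x : nat -> A.

(** The four cases are the four identities of the variety rewritten in units: no element has an
    entry (2, 1). *)
Lemma munit_variety r c a : ract (lact (U r true) a) (U false c) = 0.
Proof.
have [h1 h2 h3 h4] := varA a.
by case: r; case: c; rewrite /munit // (linfB (@ract_linr _ _ _)) ract1 ?h1 ?h3
  subrr.
Qed.

Lemma lact0 a : lact 0 a = 0.
Proof. exact: (linf0 (@lact_linl _ _ _)). Qed.

Lemma wmul0 a : wmul a 0 = 0.
Proof. exact: (linf0 (@wmul_linr _ _ _)). Qed.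

Lemma wmul0l a : wmul 0 a = 0.
Proof. exact: (linf0 (@wmul_linl _ _ _)). Qed.

Lemma lact_tword r L c : lact (U r r) (tword x r L c) = tword x r L c.
Proof.
case: L => [|[l [p q]] [|t L]]; first exact: (linf0 (@lact_linr _ _ _)).
  by rewrite /= -lractA -lactM munit_mull.
by rewrite tword_cons lact_wmul -lactM munit_mull.
Qed.

Lemma tword_invalid r L c : ~~ tvalid r L c -> tword x r L c = 0.
Proof.
elim: L r => [//|[l [p q]] [|t L] IH] r.
  rewrite /= {IH} !negb_and => /or3P[].
  - by case: r; case: p => // _; rewrite lact0 (linf0 (@ract_linl _ _ _)).
  - by case: p; case: q => // _; rewrite munit_variety.
  by case: q; case: c => // _; rewrite (linf0 (@ract_linr _ _ _)).
rewrite tword_cons !negb_and -/tvalid => /or3P[||/IH ->]; last exact: wmul0.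
  by case: r; case: p => // _; rewrite lact0 wmul0l.
case: p; case: q => // _.
(* For a descent at a variable, the unit [U q q] is drawn out of the rest of the word to meet that
   variable on its right. *)
by rewrite -lact_tword -wmul_rlact munit_variety wmul0l.
Qed.

End Variety.
End GeneralizedMonomials.

(** * Reordering of words under the commutator law *)

Section CommutatorLaw.
Variables (F : fieldType) (A : walgType F).
Hypothesis varA : ut2_variety A.
Hypothesis lawA :
  forall a b : A, wcomm a b - wcommW (wcomm a b) (e22 F) = 0.
Local Notation U := (munit F).

(** Put c = [a, b]. The law gives e_22 c = e_22 c e_22 - e_22 c, and the right side is 0 because
    e_22 c e_22 = e_22 c in the variety. *)
Lemma lawA_e22 (a b : A) : lact (e22 F) (wcomm a b) = 0.
Proof.
have [h _ _ _] := varA (wcomm a b).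
rewrite -[wcomm a b](subrK (wcommW (wcomm a b) (e22 F))) lawA add0r.
have e22K : e22 F * e22 F = e22 F by exact: (munit_mull F true true).
by rewrite (linfB (@lact_linr F A _)) -lractA h -lactM e22K subrr.
Qed.

Lemma lawA_e11 (a b : A) : ract (wcomm a b) (1 - e22 F) = 0.
Proof.
rewrite (linfB (@ract_linr F A _)) ract1 -[RHS](lawA a b) /wcommW.
by rewrite lawA_e22 subr0.
Qed.

(** For p = 1 this is [lawA_e11] applied to e_11 a and e_11 b. For p = 2 the variety removes every
    e_22 but the leftmost, which leaves e_22 [a, b] = 0. *)
Lemma corner_comm p (a b : A) :
  ract (wmul (lact (U p p) a) (lact (U p p) b)) (U p p) =
  ract (wmul (lact (U p p) b) (lact (U p p) a)) (U p p).
Proof.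
case: p; last first.
  apply/eqP; rewrite -subr_eq0 -(linfB (@ract_linl F A _)).
  by rewrite [_ - _]/(wcomm _ _) lawA_e11.
have E (c d : A) : ract (wmul (lact (U true true) c) (lact (U true true) d))
    (U true true) = lact (e22 F) (wmul c d).
  rewrite -wmul_rlact; have [-> _ _ _] := varA c.
  by rewrite -lact_wmul; have [-> _ _ _] := varA (wmul c d).
rewrite !E; apply/eqP; rewrite -subr_eq0 -(linfB (@lact_linr F A _)).
by rewrite [_ - _]/(wcomm _ _) lawA_e22.
Qed.

Variable x : nat -> A.
Local Notation letter := (nat * (bool * bool))%type.
Implicit Types (s t : seq letter) (a b : letter).

(** Factoring the surrounding units through [U p p] places both letters in the commutative
    corner. *)
Lemma tword_swap r p s c a b : a.2 = (p, p) -> b.2 = (p, p) ->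
  tword x r (a :: b :: s) c = tword x r (b :: a :: s) c.
Proof.
case: a b => [l _] [k _] /= -> ->.
have E i j : ract (wmul (lact (U r p) (x i)) (lact (U p p) (x j))) (U p p) =
    ract (wmul (lact (U r p) (x j)) (lact (U p p) (x i))) (U p p).
  rewrite -[U r p]munit_mulr !lactM -![wmul (lact (U r p) _) _]lact_wmul.
  by rewrite !lractA corner_comm.
case: s => [|t s].
  by rewrite -!ract_wmul -(munit_mull F p c) !ractM E.
rewrite -/(tword x p (t :: s) c) !wmulA -(lact_tword x p (t :: s) c).
by rewrite -![wmul _ (lact _ (tword _ _ _ _))]wmul_rlact E.
Qed.

(** The emptiness condition reflects that a one-letter word carries the final unit itself and is not
    the product of a letter with [[::]], whose value is 0. *)
Lemma tword_skip r a s t c : (s == [::]) = (t == [::]) ->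
  tword x a.2.2 s c = tword x a.2.2 t c ->
  tword x r (a :: s) c = tword x r (a :: t) c.
Proof.
case: a => [l [p q]] /=; case: s => [|b s]; case: t => [|d t] // _.
by rewrite -!/(tword _ _ (_ :: _) _) => ->.
Qed.

Lemma tword_move r p s t c a : a.2 = (p, p) ->
  {in s, forall b, b.2 = (p, p)} ->
  tword x r (s ++ a :: t) c = tword x r (a :: s ++ t) c.
Proof.
move=> ap; elim: s r => [//|b s IH] r sp.
have bp : b.2 = (p, p) by apply: sp; rewrite mem_head.
rewrite -(@tword_swap r p (s ++ t)) // !cat_cons.
apply: tword_skip; first by case: s {IH sp}.
by apply: IH => d ds; apply: sp; rewrite in_cons ds orbT.
Qed.

Lemma tvalid_ge r s c b : tvalid r s c -> b \in s ->
  (r ==> b.2.1) && (b.2.1 ==> b.2.2).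
Proof.
elim: s r => [//|[l [p q]] s IH] r /= /and3P[rp pq vs].
rewrite in_cons => /predU1P[-> /=|/(IH _ vs) /andP[qb ->]]; first by rewrite rp.
by rewrite andbT; move: rp pq qb {vs}; case: r; case: p; case: q.
Qed.

Lemma tvalid_le r s a t c b : tvalid r (s ++ a :: t) c -> b \in s ->
  b.2.2 ==> a.2.1.
Proof.
elim: s r => [//|[l [p q]] s IH] r /= /and3P[_ _ vs].
rewrite in_cons => /predU1P[-> /=|/(IH _ vs) //].
have : a \in s ++ a :: t by rewrite mem_cat mem_head orbT.
by move=> /(tvalid_ge vs)/andP[].
Qed.

Lemma tvalid_const p s t c : {in s, forall b, b.2 = (p, p)} ->
  tvalid p (s ++ t) c = tvalid p t c.
Proof.
elim: s => [//|[l τ] s IH] sp.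
have /= -> := sp _ (mem_head _ _).
rewrite implybb /=; apply: IH => b bs.
by apply: sp; rewrite in_cons bs orbT.
Qed.

(* Valid words have sorted types, so a letter that has to move to the front
   only jumps over letters of its own type. *)
Lemma tword_perm r s t c : tvalid r s c -> tvalid r t c -> perm_eq s t ->
  tword x r s c = tword x r t c.
Proof.
elim: s r t => [|[l [p q]] s IH] r t vs vt.
  by move=> /perm_size/esym/size0nil ->.
set a := (l, (p, q)) in vs *; move=> pst.
have at_ : a \in t by rewrite -(perm_mem pst) mem_head.
case/splitPr: at_ vt pst => t1 t2 vt pst.
have pst' : perm_eq s (t1 ++ t2).
  rewrite -(perm_cons a) (perm_trans pst) // perm_catC /= perm_cons.
  by rewrite perm_catC.
have /and3P[rp pq vs'] : [&& r ==> p, p ==> q & tvalid q s c] by [].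
(* A letter before [a] in [t] comes after [a] in [s]: its type lies between q and p, while p <= q,
   so all these indices agree. *)
have t1p b : b \in t1 -> b.2 = (q, q) /\ p = q.
  move=> bt; have bs : b \in s by rewrite (perm_mem pst') mem_cat bt.
  have /andP[qb bb] := tvalid_ge vs' bs; have /= ba := tvalid_le vt bt.
  case: b {bt bs} qb bb ba => [k [p' q']] /=.
  by case: (p) pq; case: (q); case: p'; case: q'.
have [t10|[pq' t1q]] : t1 = [::] \/ p = q /\ {in t1, forall b, b.2 = (q, q)}.
- case: (t1) t1p => [|b t'] t1p; [by left | right; split].
    by have [] := t1p b (mem_head _ _).
  by move=> d /t1p[].
- rewrite t10 !cat0s in vt pst' *; case/and3P: vt => _ _ vt'.
  apply: tword_skip; last exact: IH.
  by rewrite -!size_eq0 (perm_size pst').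
rewrite (@tword_move r q t1) //; last by rewrite /= pq'.
apply: tword_skip; first by rewrite -!size_eq0 (perm_size pst').
apply: IH => //; rewrite tvalid_const //.
case: t1 t1q vt {pst pst' t1p} => [|b t1] t1q /= => [/and3P[]//|].
have bq := t1q b (mem_head _ _).
case: b bq t1q => [k _] /= -> t1q /and3P[_ _].
rewrite tvalid_const => [/and3P[]//|d dt].
by apply: t1q; rewrite in_cons dt orbT.
Qed.

End CommutatorLaw.

(** * Values of words on UT_2 and their linear independence *)

Section Evaluation.
Variable F : fieldType.
Local Notation U := (munit F).
Local Notation letter := (nat * (bool * bool))%type.

Lemma tvalid_trans r (L : seq letter) c : tvalid r L c -> r ==> c.
Proof.
elim: L r => [//|[l [p q]] L IH] r /= /and3P[rp pq /IH].
by case: r rp; case: p pq; case: q.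
Qed.

Lemma tword_ut2 (a : nat -> UT2 F) r L c : tvalid r L c -> L <> [::] ->
  tword a r L c =
    (\prod_(t <- L) a t.1 (ix t.2.1) (ix t.2.2)) *: U r c.
Proof.
elim: L r => [//|[l [p q]] [|t L] IH] r vL _.
  by case/and3P: vL => rp pq qc; rewrite big_seq1 -(munit_sandwich _ rp).
have /and3P[rp pq vL'] : [&& r ==> p, p ==> q & tvalid q (t :: L) c] by [].
rewrite tword_cons IH // [in RHS]big_cons -[LHS]/(_ * _) -scalerAr.
rewrite -[lact _ _]/(_ * _) munit_sandwich ?(tvalid_trans vL') //.
by rewrite scalerA mulrC.
Qed.

Definition ut2_of (m : bool * bool -> F) : UT2 F :=
  m (false, false) *: U false false + m (false, true) *: U false true
  + m (true, true) *: U true true.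

Lemma ut2_of_entry m p q : p ==> q -> ut2_of m (ix p) (ix q) = m (p, q).
Proof.
pose M := m (false, false) *: ut2_mx (U false false)
  + m (false, true) *: ut2_mx (U false true)
  + m (true, true) *: ut2_mx (U true true).
rewrite -[ut2_of m (ix p) (ix q)]/(M (ix p) (ix q)) /M !munit_mx !scale1r.
by case: p; case: q => // _; rewrite !mxE /= ?(mulr0, mulr1, addr0, add0r).
Qed.

(** Induction on [s]: subtracting [chi i0 m0] times the relation at [m] from the relation at
    [mulM m0 m] eliminates [i0]. The shorter relation has coefficients
    [k j * (chi j m0 - chi i0 m0)], so a nonzero [k j] would make [chi j] and [chi i0] equal. *)
Lemma dedekind (M : Type) (mulM : M -> M -> M) (one : M) (K : eqType)
    (chi : K -> M -> F) (s : seq K) (k : K -> F) :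
  uniq s ->
  {in s, forall i, {morph chi i : m m' / mulM m m' >-> m * m'}} ->
  {in s, forall i, chi i one = 1} ->
  {in s &, forall i j, chi i =1 chi j -> i = j} ->
  (forall m, \sum_(i <- s) k i * chi i m = 0) -> {in s, forall i, k i = 0}.
Proof.
elim: s k => [//|i0 s IH] k /= /andP[i0s us] chiM chi1 inj sum0.
have i0s' := mem_head i0 s.
have ss j : j \in s -> j \in i0 :: s by rewrite in_cons => ->; rewrite orbT.
have injs : {in s &, forall i j, chi i =1 chi j -> i = j}.
  by move=> j l /ss js /ss; apply: inj.
have k0 : {in s, forall i, k i = 0}.
  move=> i is_; have ii0 : i <> i0 by move=> ii0; rewrite -ii0 is_ in i0s.
  apply/eqP; apply: contra_notT ii0 => ki.
  apply: (inj) => // [|m0]; first exact: ss.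
  apply/eqP; rewrite -subr_eq0.
  suff /eqP : k i * (chi i m0 - chi i0 m0) = 0.
    by rewrite mulf_eq0 (negPf ki).
  apply: (IH (fun j => k j * (chi j m0 - chi i0 m0))) is_ => //
    [j /ss|j /ss|m]; [exact: chiM | exact: chi1 |].
  transitivity (\sum_(i <- i0 :: s) k i * chi i (mulM m0 m)
                - chi i0 m0 * \sum_(i <- i0 :: s) k i * chi i m); last first.
    by rewrite !sum0 mulr0 subrr.
  rewrite !big_cons chiM // mulrDr mulr_sumr opprD.
  rewrite addrACA [X in X + _](_ : _ = 0) ?add0r; last first.
    by rewrite mulrCA subrr.
  rewrite -sumrB !big_seq; apply: eq_bigr => j /ss js.
  rewrite chiM // mulrBr mulrBl.
  by rewrite [chi i0 m0 * (_ * _)]mulrCA !mulrA.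
move=> i; rewrite in_cons => /predU1P[->|/k0 //].
have := sum0 one; rewrite big_cons chi1 // mulr1 big_seq big1 ?addr0 // => j js.
by rewrite k0 // mul0r.
Qed.

Lemma ut2_entry_linear r c :
  linear (fun w : UT2 F => w (ix r) (ix c) : F^o).
Proof. by move=> k u v; rewrite /= !mxE. Qed.

Lemma munit_entry r c r0 c0 : r ==> c ->
  U r c (ix r0) (ix c0) = ((r, c) == (r0, c0))%:R.
Proof.
move=> rc; rewrite munit_mx rc scale1r mxE.
by case: r c r0 c0 {rc} => [] [] [] [].
Qed.

Definition lmonom (L : seq letter) (m : nat -> bool * bool -> F) : F :=
  \prod_(t <- L) m t.1 t.2.

(** Giving one entry the value 2 and all others the value 1 turns a monomial into 2 to the
    multiplicity of that entry; these powers are distinct in characteristic zero. *)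
Lemma lmonom_inj L L' : [pchar F] =i pred0 ->
  lmonom L =1 lmonom L' -> perm_eq L L'.
Proof.
move=> char0 E; apply/allP => t _ /=; apply/eqP.
have E2 s : lmonom s (fun l e => if (l, e) == t then 2 else 1) =
    (2 ^ count_mem t s)%:R.
  rewrite /lmonom; elim: s => [|u s IH]; first by rewrite big_nil.
  rewrite big_cons IH /= expnD natrM -surjective_pairing.
  by case: (u == t).
move: (E (fun l e => if (l, e) == t then 2 else 1)); rewrite !E2.
wlog le : L L' {E} / (count_mem t L <= count_mem t L')%N.
  move=> W; case: (leqP (count_mem t L) (count_mem t L')) => [/W//|/ltnW le] e.
  by apply/esym/W.
move/eqP; rewrite -subr_eq0 -opprB oppr_eq0 -natrB ?leq_exp2l //.
rewrite ((pcharf0P F).1 char0) subn_eq0 leq_exp2l // => le'.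
by apply/eqP; rewrite eqn_leq le.
Qed.

(** The keys will be monomial functions, which form no finite type, so the outer sum runs over the
    keys that occur. *)
Lemma big_partition_seq (V : nmodType) (J K : eqType) (key : J -> K)
    (s : seq J) (P : pred J) (G : J -> V) :
  \sum_(j <- s | P j) G j =
  \sum_(i <- undup [seq key j | j <- s & P j])
    \sum_(j <- s | P j && (key j == i)) G j.
Proof.
rewrite (exchange_big_dep P) /= => [|i j _ /andP[] //].
rewrite big_seq_cond [RHS]big_seq_cond; apply: eq_bigr => j /andP[js Pj].
rewrite -big_filter (eq_filter (a2 := pred1 (key j))).
  rewrite filter_pred1_uniq ?undup_uniq ?big_seq1 // mem_undup.
  by apply: map_f; rewrite mem_filter Pj.
by move=> i; rewrite /= Pj eq_sym.
Qed.

(* Distinct monomials in the entries of the x_l are distinct characters of the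
   multiplicative monoid of their values, hence linearly independent. *)
Lemma tword_indep (V : lmodType F) (J : eqType) (s : seq J) (k : J -> F)
    (v : J -> V) (r : J -> bool) (L : J -> seq letter) (c : J -> bool) :
  [pchar F] =i pred0 ->
  {in s, forall j, tvalid (r j) (L j) (c j) /\ L j <> [::]} ->
  {in s &, forall i j, r i = r j -> c i = c j -> perm_eq (L i) (L j) ->
    v i = v j} ->
  (forall a : nat -> UT2 F, \sum_(j <- s) k j *: tword a (r j) (L j) (c j) = 0)
  -> \sum_(j <- s) k j *: v j = 0.
Proof.
move=> char0 vL vE sum0.
(* The entry (r0, c0) of the relation isolates the words with these ends, and [ut2_of] lets the
   entries of the variables take arbitrary values. *)
have coef0 r0 c0 m :
    \sum_(j <- s | (r j == r0) && (c j == c0)) k j * lmonom (L j) m = 0.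
  have [rc|nrc] := boolP (r0 ==> c0); last first.
    rewrite big_seq_cond big1 // => j /and3P[js /eqP rj /eqP cj].
    have [/tvalid_trans] := vL _ js.
    by rewrite rj cj (negPf nrc).
  have := congr1 (fun w : UT2 F => w (ix r0) (ix c0))
    (sum0 (fun l => ut2_of (m l))).
  rewrite (linf_sum (ut2_entry_linear r0 c0)) (linf0 (ut2_entry_linear r0 c0)).
  move=> E; rewrite -[RHS]E {E} big_mkcond [LHS]big_seq [RHS]big_seq.
  apply: eq_bigr => j js; have [vj Ln] := vL _ js; rewrite tword_ut2 //.
  rewrite !(linfZ (ut2_entry_linear r0 c0)) munit_entry ?(tvalid_trans vj) //.
  rewrite -[RHS]/(_ * (_ * _)) mulr_natr /lmonom big_seq [in RHS]big_seq.
  rewrite [in RHS](eq_bigr (fun t => m t.1 t.2)) => [|t tL].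
    by rewrite xpair_eqE; case: (_ && _); rewrite ?mulr1n ?mulr0n ?mulr0.
  have /andP[_ pq] := tvalid_ge vj tL.
  by rewrite ut2_of_entry // -surjective_pairing.
rewrite (partition_big (fun j => (r j, c j)) xpredT) //= big1 // => -[r0 c0] _.
pose pos j := (r j, c j) == (r0, c0).
rewrite (big_partition_seq (fun j => lmonom (L j))) big_seq big1 // => chi.
rewrite mem_undup => /mapP[j0]; rewrite mem_filter => /andP[pj0 j0s ->].
(* All words of one class share the vector [v j0], so it remains to see that their coefficients sum
   to 0. *)
rewrite big_seq_cond (eq_bigr (fun j => k j *: v j0)); last first.
  move=> j /and3P[js /eqP[rj cj] /eqP Lj]; congr (_ *: _).
  have /eqP[rj0 cj0] := pj0; apply: vE => //; rewrite ?rj ?cj //.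
  by apply: lmonom_inj => // m; rewrite Lj.
rewrite -big_seq_cond -scaler_suml [X in X *: _](_ : _ = 0) ?scale0r //.
pose X := undup [seq lmonom (L j) | j <- s & pos j].
pose D chi := \sum_(j <- s | pos j && (lmonom (L j) == chi)) k j.
apply: (@dedekind _ (fun m m' l e => m l e * m' l e) (fun _ _ => 1) _
          (fun chi m => chi m) X D).
- exact: undup_uniq.
- move=> chi'; rewrite mem_undup => /mapP[j _ ->] m m'.
  by rewrite /lmonom -big_split.
- by move=> chi'; rewrite mem_undup => /mapP[j _ ->]; rewrite /lmonom big1.
- by move=> chi1 chi2 _ _ E; apply: funext.
- move=> m; rewrite -[RHS](coef0 r0 c0 m).
  rewrite (big_partition_seq (fun j => lmonom (L j))).
  apply: eq_bigr => chi' _; rewrite mulr_suml.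
  by apply: eq_bigr => j /andP[_ /eqP ->].
by rewrite mem_undup; apply/mapP; exists j0; rewrite // mem_filter j0s andbT.
Qed.

End Evaluation.

(** * Homomorphisms of W-algebras *)

Section Homomorphisms.
Variables (F : fieldType) (A B : walgType F) (f : A -> B) (fW : is_whom f).

Lemma whomL w a : f (lact w a) = lact w (f a).
Proof. by rewrite -[lact w a]ract1 (whomLR fW) ract1. Qed.

Lemma whomR a w : f (ract a w) = ract (f a) w.
Proof. by rewrite -[a in LHS]lact1 (whomLR fW) lact1. Qed.

Lemma whom_comp (C : walgType F) (g : B -> C) : is_whom g ->
  is_whom (fun a => g (f a)).
Proof.
move=> gW; split=> [k a b|a b|w a v].
- by rewrite (whom_linear fW) (whom_linear gW).
- by rewrite (whomM fW) (whomM gW).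
by rewrite (whomLR fW) (whomLR gW).
Qed.

Lemma whom_tword x r L c :
  f (tword x r L c) = tword (fun i => f (x i)) r L c.
Proof.
elim: L r => [|[l [p q]] [|t L] IH] r.
- exact: (linf0 (whom_linear fW)).
- by rewrite /= (whomLR fW).
by rewrite !tword_cons (whomM fW) whomL IH.
Qed.

Lemma whom_feval x g : f (feval x g) = feval (fun i => f (x i)) g.
Proof.
rewrite /feval /mlin (linf_sum (whom_linear fW)); apply: eq_bigr => u _.
rewrite (linfZ (whom_linear fW)); congr (_ *: _).
case: u => [[b [j s]] c] /=; rewrite whomR; congr (ract _ _).
rewrite -whomL; elim: s (lact _ (x j)) => [//|[e k] s IH] p /=.
by rewrite IH (whomM fW) whomL.
Qed.

Lemma whom_variety : (forall b, exists a, b = f a) ->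
  ut2_variety A -> ut2_variety B.
Proof.
move=> fsurj varA b; have [a ->] := fsurj b; have [h1 h2 h3 h4] := varA a.
rewrite -!whomL -!whomR h1 h2 h3 h4.
by split; rewrite ?(linf0 (whom_linear fW)).
Qed.

End Homomorphisms.

Lemma wpi_whom (F : fieldType) (A : walgType F) (I : set A)
  (II : is_wideal I) : is_whom (wpi II : A -> wquot II).
Proof.
split=> [|a b|w a v]; first exact: wpi_linear.
  by rewrite [RHS]wqmulE.
by rewrite [lact _ (wpi _ _)]wqlactE [RHS]wqractE.
Qed.

(** * Substitutions, T-ideals and the quotient by the law *)

Section Substitutions.
Variable F : fieldType.

Lemma ut2_entry_diag (a b : UT2 F) p :
  (a * b) (ix p) (ix p) = a (ix p) (ix p) * b (ix p) (ix p).
Proof.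
have low (d : UT2 F) : d (ix true) (ix false) = 0.
  have := valP d; rewrite unfold_in => /is_trig_mxP/(_ 0 1 isT).
  by rewrite mxE.
rewrite -[LHS]/((ut2_mx a *m ut2_mx b) (ix p) (ix p)) mxE.
rewrite !big_ord_recl big_ord0.
have -> : lift ord0 ord0 = ix true by apply: val_inj.
have -> : ord0 = ix false by apply: val_inj.
by case: p; rewrite !low ?(mul0r, mulr0) !(addr0, add0r).
Qed.

Lemma feval_fgen (g : wfree F) : feval (@fgen F) g = g.
Proof.
move: g; apply: mlin_uniq => [||[[b [j s]] c]]; [exact: feval_linear|by []|].
rewrite /feval mlinU /=.
have lactE e k :
    lact (wbasis F e) (fgen F k) = << (e, (k, [::]), ord0) : word >>.
  by rewrite [LHS]flactU /wbasis [tnth _ ord0](tnth_nth 0) mulr1 wext_wbasis.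
rewrite lactE; set fold := foldl _ _ _.
have -> : fold = << (b, (j, s), ord0) : word >>.
  rewrite /fold {fold} -[in RHS](cat0s s); elim: s [::] => [|[e k] s IH] s0 /=.
    by rewrite cats0.
  rewrite lactE [wmul _ _]fmulU -cat_rcons -IH -cats1; congr foldl.
  by rewrite {1}/wbasis (tnth_nth 0) mul1r wext_wbasis.
by rewrite [LHS]fractU {1}/wbasis (tnth_nth 0) mul1r wext_wbasis.
Qed.

(** Substituting the variables for themselves changes nothing; this form makes [feval_span]
    applicable to every generalized polynomial. *)
Lemma gpoly_feval (f : gpoly F) : exists g, f = feval (gX F) g.
Proof.
elim/wquotW: f => g; exists g.
by rewrite -{1}[g]feval_fgen (whom_feval (wpi_whom _)).
Qed.

(** Uniqueness in the universal property of UT_2<X>: both sides agree on the variables. *)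
Lemma whom_geval (A : walgType F) (f : gpoly F -> A) : ut2_variety A ->
  is_whom f -> f =1 geval (fun i => f (gX F i)).
Proof.
move=> varA fW h; have [g ->] := gpoly_feval h.
rewrite (whom_feval fW) (whom_feval (geval_whom _ varA)).
by congr feval; apply: funext => i; rewrite geval_gX.
Qed.

Lemma whom_wideal (A B : walgType F) (f : A -> B) : is_whom f ->
  is_wideal [set a | f a = 0].
Proof.
move=> fW; have fL := whom_linear fW; split => /=.
- exact: linf0.
- by move=> a b a0 b0; rewrite (linfD fL) a0 b0 addr0.
- by move=> k a a0; rewrite (linfZ fL) a0 scaler0.
- by move=> a b b0; rewrite (whomM fW) b0 wmul0.
- by move=> a b a0; rewrite (whomM fW) a0 wmul0l.
- by move=> w a a0; rewrite (whomL fW) a0 (linf0 (@lact_linr _ _ _)).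
by move=> w a a0; rewrite (whomR fW) a0 (linf0 (@ract_linl _ _ _)).
Qed.

(** [GId A] is the intersection of the kernels of all evaluations, and an endomorphism followed by
    an evaluation is again an evaluation. *)
Lemma GId_Tideal (A : walgType F) : ut2_variety A -> is_Tideal (GId A).
Proof.
move=> varA; split; last first.
  move=> phi phiW f fA a; have aW := geval_whom a varA.
  by rewrite (whom_geval varA (whom_comp phiW aW)) fA.
have W a := whom_wideal (geval_whom a varA).
split=> [a|f g fA gA a|k f fA a|f g gA a|f g fA a|w f fA a|w f fA a].
- exact: (wideal0 (W a)).
- exact: (widealD (W a) (fA a) (gA a)).
- exact: (widealZ (W a) k (fA a)).
- exact: (widealMl (W a) f (gA a)).
- exact: (widealMr (W a) g (fA a)).
- exact: (widealL (W a) w (fA a)).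
exact: (widealR (W a) w (fA a)).
Qed.

Lemma Tideal_genP (S : set (gpoly F)) : is_Tideal (Tideal_gen S).
Proof.
split; last first.
  by move=> phi phiW f fS I IT SI; apply: IT.2 => //; apply: fS.
split.
- by move=> I [II _] _; apply: wideal0.
- by move=> a b ha hb I IT SI; apply: (widealD IT.1); [apply: ha | apply: hb].
- by move=> k a ha I IT SI; apply: (widealZ IT.1); apply: ha.
- by move=> a b ha I IT SI; apply: (widealMl IT.1); apply: ha.
- by move=> a b ha I IT SI; apply: (widealMr IT.1); apply: ha.
- by move=> w a ha I IT SI; apply: (widealL IT.1); apply: ha.
by move=> w a ha I IT SI; apply: (widealR IT.1); apply: ha.
Qed.

Definition comm_law (A : walgType F) (a b : A) : A :=
  wcomm a b - wcommW (wcomm a b) (e22 F).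

Local Notation lawI := (Tideal_gen [set comm_law (gX F 0) (gX F 1)]).
Local Notation lawQ := (wquot (Tideal_genP [set comm_law (gX F 0) (gX F 1)]).1).

Lemma whom_comm_law (A B : walgType F) (f : A -> B) a b : is_whom f ->
  f (comm_law a b) = comm_law (f a) (f b).
Proof.
move=> fW; have fL := whom_linear fW.
rewrite /comm_law /wcommW /wcomm !(linfB fL) (whomR fW) (whomL fW).
by rewrite !(linfB fL) !(whomM fW).
Qed.

(** Representatives of a and b are the images of the first two variables under a substitution, and
    the T-ideal is stable under it. *)
Lemma lawQ_law (a b : lawQ) : comm_law a b = 0.
Proof.
elim/wquotW: a => a; elim/wquotW: b => b.
rewrite -(whom_comm_law _ _ (wpi_whom _)) -(linf0 (wpi_linear _)).
apply/wpiP; rewrite subr0.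
pose s i := if i is 0%N then a else b.
have sW := geval_whom s (@gpoly_variety F).
have := (Tideal_genP [set comm_law (gX F 0) (gX F 1)]).2 _ sW.
move=> /(_ (comm_law (gX F 0) (gX F 1))).
rewrite (whom_comm_law _ _ sW) !geval_gX; try exact: gpoly_variety.
by apply=> I _; apply.
Qed.

Lemma lawQ_variety : ut2_variety lawQ.
Proof.
apply: whom_variety (wpi_whom _) _ (@gpoly_variety F).
by move=> q; exists (repr q); rewrite wpiK.
Qed.

(** A commutator of upper triangular matrices is a multiple of e_12, and [e_12, e_22] = e_12. *)
Lemma ut2_law (a b : UT2 F) : comm_law a b = 0.
Proof.
pose c := a * b - b * a.
have c0 p : c (ix p) (ix p) = 0.
  rewrite /c (linfB (ut2_entry_linear p p)) !ut2_entry_diag.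
  by rewrite [X in _ - X]mulrC subrr.
rewrite /comm_law -[wcomm a b]/c -[wcommW _ _]/(c * e22 F - e22 F * c).
rewrite [c]munit_expand !c0 !scale0r add0r addr0 -scalerAl -scalerAr.
have -> : e22 F * munit F false true = 0.
  rewrite -[e22 F]mulr1.
  by have [_ h _ _] := ut2_in_variety (1 : UT2 F); exact: h.
by rewrite (munit_mulr F false true) scaler0 subr0 subrr.
Qed.

Lemma lawI_GId : lawI `<=` GId (UT2 F).
Proof.
move=> f; apply; first exact/GId_Tideal/ut2_in_variety.
move=> _ -> a; rewrite (whom_comm_law _ _ (geval_whom a (@ut2_in_variety F))).
exact: ut2_law.
Qed.

End Substitutions.

(** * The kernel of evaluation on UT_2 *)

Section Kernel.
Variables (F : fieldType) (Q : walgType F) (pi : gpoly F -> Q).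
Hypothesis char0 : [pchar F] =i pred0.
Hypothesis piW : is_whom pi.
Hypothesis varQ : ut2_variety Q.
Hypothesis lawQ : forall a b : Q, comm_law a b = 0.
Hypothesis kerQ : [set f | pi f = 0] `<=` GId (UT2 F).
Local Notation letter := (nat * (bool * bool))%type.

Let varU := @ut2_in_variety F.
Let x i := pi (gX F i).

Lemma geval_tword (a : nat -> UT2 F) r L c :
  geval a (tword (gX F) r L c) = tword a r L c.
Proof.
rewrite (whom_tword (geval_whom a varU)).
by congr tword; apply: funext => i; rewrite geval_gX.
Qed.

(** In [Q] the image of [f] is a combination of valid words. A relation among valid words that holds
    on UT_2 also holds in [Q], because words with equal data coincide there. *)
Lemma GId_ker f : GId (UT2 F) f -> pi f = 0.
Proof.
move=> fId.
pose val (j : F * (bool * seq letter * bool)) :=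
  j.1 *: tword x j.2.1.1 j.2.1.2 j.2.2.
pose P : set Q := [set v | exists2 s,
  {in s, forall j, tvalid j.2.1.1 j.2.1.2 j.2.2 /\ j.2.1.2 <> [::]} &
  v = \sum_(j <- s) val j].
have subP : is_subspace P.
  split; first by exists [::]; rewrite // big_nil.
  move=> k a b [s sV ->] [t tV ->].
  exists ([seq (k * j.1, j.2) | j <- s] ++ t) => [j|].
    by rewrite mem_cat => /orP[/mapP[i /sV iV ->]|/tV].
  rewrite big_cat big_map scaler_sumr; congr (_ + _).
  by apply: eq_bigr => j _; rewrite /val scalerA.
have [s sV E] : P (pi f).
  have [g ->] := gpoly_feval f; rewrite (whom_feval piW).
  apply: feval_span => // r L c Ln.
  have [vL|/(tword_invalid varQ x) ->] := boolP (tvalid r L c); last first.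
    exact: subspace0.
  exists [:: (1, (r, L, c))] => [j|]; first by rewrite inE => /eqP ->.
  by rewrite big_seq1 /val scale1r.
rewrite E; apply: (tword_indep char0 sV) => [i j /sV[vi _] /sV[vj _] rE cE p|a].
  by rewrite rE cE; apply: tword_perm => //; rewrite -?rE -?cE.
(* The same combination lifted to UT_2<X>. It differs from [f] by an element of the kernel of [pi],
   hence by an identity of UT_2, so it vanishes on UT_2 together with [f]. *)
pose G := \sum_(j <- s) j.1 *: tword (gX F) j.2.1.1 j.2.1.2 j.2.2.
have piG : pi (G - f) = 0.
  rewrite (linfB (whom_linear piW)) E (linf_sum (whom_linear piW)) -sumrB.
  apply: big1 => j _.
  by rewrite (linfZ (whom_linear piW)) (whom_tword piW) subrr.
have := kerQ piG a; rewrite (linfB (whom_linear (geval_whom a varU))) fId subr0.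
rewrite (linf_sum (whom_linear (geval_whom a varU))) => E0.
rewrite -[RHS]E0; apply: eq_bigr => j _.
rewrite (linfZ (whom_linear (geval_whom a varU))).
by rewrite geval_tword.
Qed.

Lemma tword_perm_GId r L L' c : tvalid r L c -> tvalid r L' c ->
  perm_eq L L' -> GId (UT2 F) (tword (gX F) r L c - tword (gX F) r L' c).
Proof.
move=> vL vL' p; apply: kerQ => /=.
rewrite (linfB (whom_linear piW)) !(whom_tword piW).
by rewrite (tword_perm varQ lawQ _ vL vL' p) subrr.
Qed.

End Kernel.

Section Main.
Variable F : fieldType.
Hypothesis char0 : [pchar F] =i pred0.
Local Notation lawI := (Tideal_gen [set comm_law (gX F 0) (gX F 1)]).
Let lawQ := wquot (Tideal_genP [set comm_law (gX F 0) (gX F 1)]).1.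
Let pi : gpoly F -> lawQ := @wpi _ _ _ _.

Lemma lawQ_ker f : pi f = 0 <-> lawI f.
Proof.
have := wpiP (Tideal_genP [set comm_law (gX F 0) (gX F 1)]).1 f 0.
by rewrite (linf0 (wpi_linear _)) subr0.
Qed.

Lemma tword_perm_ut2 r L L' c : tvalid r L c -> tvalid r L' c ->
  perm_eq L L' -> GId (UT2 F) (tword (gX F) r L c - tword (gX F) r L' c).
Proof.
pose IT := Tideal_genP [set comm_law (gX F 0) (gX F 1)].
apply: (tword_perm_GId (wpi_whom IT.1)).
- exact: lawQ_variety.
- exact: lawQ_law.
by move=> g /lawQ_ker/lawI_GId.
Qed.

Lemma GId_ut2 : GId (UT2 F) = lawI.
Proof.
apply/seteqP; split => f; last exact: lawI_GId.
move=> fId; apply/lawQ_ker; apply: (GId_ker char0 (wpi_whom _)) fId.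
- exact: lawQ_variety.
- exact: lawQ_law.
by move=> g /lawQ_ker/lawI_GId.
Qed.

End Main.

(** * Linear spans and multilinear generalized polynomials *)

Section Span.
Variables (F : fieldType) (V : lmodType F) (S : set V).

Lemma lspan_subspace : is_subspace (lspan S).
Proof.
split.
  by exists 0%N, (fun=> 0), (fun=> 0); split; [case | rewrite big_ord0].
move=> k a b [m1 [c1 [u1 [S1 ->]]]] [m2 [c2 [u2 [S2 ->]]]].
exists (m1 + m2)%N.
exists (fun i =>
  match fintype.split i with inl j => k * c1 j | inr j => c2 j end).
exists (fun i => match fintype.split i with inl j => u1 j | inr j => u2 j end).
split=> [i|]; first by case: (fintype.split i).
rewrite big_split_ord scaler_sumr; congr (_ + _); apply: eq_bigr => i _.
  by rewrite (unsplitK (inl i)) scalerA.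
by rewrite (unsplitK (inr i)).
Qed.

Lemma sub_lspan : S `<=` lspan S.
Proof.
move=> u Su; exists 1%N, (fun=> 1), (fun=> u).
by rewrite big_ord1 scale1r.
Qed.

Lemma lspan_min (P : set V) : is_subspace P -> S `<=` P -> lspan S `<=` P.
Proof.
move=> subP SP _ [m [c [u [Su ->]]]].
apply: (big_rec (fun y => P y)) => [|i y _ Py]; first exact: subspace0.
by apply: subspaceP => //; apply: SP.
Qed.

End Span.

Section MultilinearWords.
Variables (F : fieldType) (n : nat).
Hypothesis n_gt0 : (0 < n)%N.
Local Notation letter := (nat * (bool * bool))%type.

Lemma perm_iota_perm s : perm_eq s (iota 0 n) ->
  exists sigma : 'S_n, s = [seq (sigma i : nat) | i <- enum 'I_n].
Proof.
move=> p; have sz : size (iota 0 n) == n by rewrite size_iota.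
have /(@tuple_permP _ _ _ (Tuple sz)) [sigma ->] := p.
exists sigma.
by apply: eq_map => i; rewrite (tnth_nth 0%N) /= nth_iota.
Qed.

Lemma perm_perm_iota (sigma : 'S_n) :
  perm_eq [seq (sigma i : nat) | i <- enum 'I_n] (iota 0 n).
Proof.
rewrite -val_enum_ord (map_comp val sigma); apply: perm_map.
apply: uniq_perm; rewrite ?enum_uniq // ?(map_inj_uniq perm_inj) ?enum_uniq //.
move=> i; rewrite mem_enum; apply/mapP.
by exists (sigma^-1 i)%g; rewrite ?mem_enum ?permKV.
Qed.

Lemma letters_neq_nil (L : seq letter) :
  perm_eq [seq t.1 | t <- L] (iota 0 n) -> L <> [::].
Proof.
by move=> p L0; move: n_gt0; rewrite -(size_iota 0 n) -(perm_size p) L0.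
Qed.

Lemma GP_tword r (L : seq letter) c : perm_eq [seq t.1 | t <- L] (iota 0 n) ->
  GP F n (tword (gX F) r L c).
Proof.
move=> p.
have [w0 [ws [szw ->]]] := tword_gmonom (gX F) r c (letters_neq_nil p).
have [sigma E] := perm_iota_perm p; apply: sub_lspan.
have szL : size ws = n by rewrite szw -(size_map fst) (perm_size p) size_iota.
(* The list [w0 :: ws] has n + 1 entries, so the default 0 is never reached. *)
exists sigma, (fun i => nth 0 (w0 :: ws) i); congr gmonom.
rewrite (map_comp (gX F) fst) E -map_comp.
have wsE : ws = [seq nth 0 (w0 :: ws) (lift ord0 i) | i : 'I_n <- enum 'I_n].
  apply: (@eq_from_nth _ 0) => [|i]; first by rewrite size_map size_enum_ord.
  rewrite szL => i_n; rewrite (nth_map (Ordinal i_n)) ?size_enum_ord //.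
  by rewrite /= /bump nth_enum_ord.
by rewrite {1}wsE zip_map.
Qed.

Lemma GP_min (P : set (gpoly F)) : is_subspace P ->
  (forall r L c, perm_eq [seq t.1 | t <- L] (iota 0 n) ->
    P (tword (gX F) r L c)) ->
  GP F n `<=` P.
Proof.
move=> subP Pw; apply: lspan_min => // _ [sigma [w ->]].
rewrite -(zip_map (fun i => gX F (sigma i)) (fun i => w (lift ord0 i))).
rewrite (map_comp (gX F) (fun i => sigma i : nat)).
apply: gmonom_span => // [|E|r L c Ls]; first by rewrite !size_map.
  have n0 := congr1 size E; rewrite size_map size_enum_ord in n0.
  by move: n_gt0; rewrite n0.
by apply: Pw; rewrite Ls perm_perm_iota.
Qed.

End MultilinearWords.

(** * Multilinear words up to reordering *)

Section MultilinearTypes.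
Variable m : nat.
Local Notation letter := (nat * (bool * bool))%type.
Local Notation mtype :=
  (bool + ({set 'I_m.+1} + 'I_m.+1 * {set 'I_m}))%type.
Implicit Types (b : mtype) (ty : 'I_m.+1 -> bool * bool).

(* The basis modulo the identities: [inl] gives the diagonal entries, and
   [inr] the entry (1, 2), whose monomials have no entry x_(1,2) ([D] is the
   set of the variables that contribute x_(1,1)) or a single one, at [i0]. *)
Definition mrow b : bool := if b is inl e then e else false.
Definition mcol b : bool := if b is inl e then e else true.
(** The variables other than [i0] are numbered by ['I_m] through [lift i0], so that [T] ranges over
    2^m sets. *)
Definition mty b (i : 'I_m.+1) : bool * bool :=
  match b with
  | inl e => (e, e)
  | inr (inl D) => if i \in D then (false, false) else (true, true)
  | inr (inr (i0, T)) =>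
    if unlift i0 i is Some k then
      if k \in T then (false, false) else (true, true)
    else (false, true)
  end.

Definition tblock ty (e : bool * bool) : seq letter :=
  [seq (val i, ty i) | i <- enum 'I_m.+1 & ty i == e].

(** A canonical arrangement of the letters: sorting by type in this order keeps the index from
    descending. *)
Definition tletters ty : seq letter :=
  tblock ty (false, false) ++ tblock ty (false, true) ++ tblock ty (true, true).

Lemma count_enum (T : finType) (a : pred T) : count a (enum T) = #|a|.
Proof. by rewrite -sum1_count big_enum_cond -sum1_card. Qed.

Lemma tblock_ty ty e : {in tblock ty e, forall t, t.2 = e}.
Proof. by move=> _ /mapP[i + ->]; rewrite mem_filter => /andP[/eqP]. Qed.

Lemma tletters_perm ty : (forall i, (ty i).1 ==> (ty i).2) ->
  perm_eq (tletters ty) [seq (val i, ty i) | i <- enum 'I_m.+1].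
Proof.
move=> ty_le; rewrite /tletters /tblock -!map_cat; apply: perm_map.
apply/seq.permP => a; elim: (enum 'I_m.+1) => [//|i s].
rewrite !count_cat !count_filter /= => <-.
have := ty_le i; case: (a i) (ty i) => [] [[] []] //= _;
  by rewrite ?add0n -?addnA ?(addnCA _ 1%N).
Qed.

Lemma tletters_mem ty i : (forall i, (ty i).1 ==> (ty i).2) ->
  ((val i, ty i) : letter) \in tletters ty.
Proof.
move=> ty_le; rewrite (perm_mem (tletters_perm ty_le)); apply/mapP.
by exists i; rewrite ?mem_enum.
Qed.

(** Each variable occurs exactly once, so its type can be read off from the multiset of letters. *)
Lemma tletters_inj ty ty' : (forall i, (ty i).1 ==> (ty i).2) ->
  (forall i, (ty' i).1 ==> (ty' i).2) ->
  perm_eq (tletters ty) (tletters ty') -> ty =1 ty'.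
Proof.
move=> le le' p i; have := tletters_mem i le.
rewrite (perm_mem p) (perm_mem (tletters_perm le')) => /mapP[j _ [ij ->]].
by congr ty'; apply: val_inj.
Qed.

Lemma mty_le b i : (mty b i).1 ==> (mty b i).2.
Proof.
case: b => [[]//|[D|[i0 T]]] /=; first by case: ifP.
by case: unlift => // k; case: ifP.
Qed.

Lemma tletters_letters b :
  perm_eq [seq t.1 | t <- tletters (mty b)] (iota 0 m.+1).
Proof.
rewrite (perm_trans (perm_map fst (tletters_perm (mty_le b)))) //.
by rewrite -map_comp -val_enum_ord.
Qed.

Lemma tvalid_ones r (s : seq letter) :
  {in s, forall t, t.2 = (true, true)} -> tvalid r s true.
Proof.
elim: s r => [|[l e] s IH] r sp /=; first exact: implybT.
have /= -> := sp _ (mem_head _ _); rewrite implybT /=; apply: IH => t ts.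
by apply: sp; rewrite in_cons ts orbT.
Qed.

Lemma tvalid_mty b : tvalid (mrow b) (tletters (mty b)) (mcol b).
Proof.
have off ty e : (forall i, ty i != e) -> tblock ty e = [::].
  move=> ne; rewrite /tblock (eq_filter (a2 := pred0)) ?filter_pred0 // => i.
  by rewrite (negPf (ne i)).
case: b => [[]|b].
- rewrite /tletters [tblock _ (false, false)]off //.
  rewrite [tblock _ (false, true)]off //.
  exact: tvalid_ones (@tblock_ty _ _).
- rewrite /tletters [tblock _ (false, true)]off //.
  rewrite [tblock _ (true, true)]off //.
  by rewrite (tvalid_const _ _ (@tblock_ty _ _)).
rewrite /tletters (tvalid_const _ _ (@tblock_ty _ _)).
have ones := @tvalid_ones _ _ (@tblock_ty (mty (inr b)) (true, true)).
(* The middle block may hold one letter at most, since a second one would make the index jump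
   twice. *)
have : (size (tblock (mty (inr b)) (false, true)) <= 1)%N.
  rewrite size_map size_filter count_enum; apply/card_le1_eqP => i j.
  move=> /eqP; case: b {ones} => [D|[i0 T]] /=; first by case: ifP.
  case: unliftP => [k|] ->; first by case: ifP.
  by move=> _ /eqP; case: unliftP => [k|] -> //; case: ifP.
have := @tblock_ty (mty (inr b)) (false, true).
case: tblock => [|[l e] [|//]] //= h _.
by have /= -> := h _ (mem_head _ _); rewrite /= ones.
Qed.

(** The ends separate the diagonal cases from the others; the presence of a letter of type (1, 2)
    separates the remaining two, and its variable is [i0]. *)
Lemma mty_inj b b' : mrow b = mrow b' -> mcol b = mcol b' ->
  perm_eq (tletters (mty b)) (tletters (mty b')) -> b = b'.
Proof.
move=> rE cE /(tletters_inj (mty_le b) (mty_le b')) tE.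
move: rE cE tE.
case: b => [e|[D|[i0 T]]]; case: b' => [e'|[D'|[i1 T']]] /=.
- by move=> ->.
- by case: e.
- by case: e.
- by case: e'.
- move=> _ _ tE; congr (inr (inl _)); apply/setP => i.
  by have /= := tE i; case: ifP; case: ifP.
- by move=> _ _ /(_ i1) /=; rewrite unlift_none; case: ifP.
- by case: e'.
- by move=> _ _ /(_ i0) /=; rewrite unlift_none; case: ifP.
move=> _ _ tE; have /= := tE i0; rewrite unlift_none.
case: unliftP => [k _|i01 _]; first by case: ifP.
congr (inr (inr _)); rewrite -i01 in tE *; congr (_, _); apply/setP => k.
by have /= := tE (lift i0 k); rewrite liftK; case: ifP; case: ifP.
Qed.

(** The index can pass from 1 to 2 only once, and not at all when it starts at 2. *)
Lemma tvalid_count r (s : seq letter) c : tvalid r s c ->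
  (count (fun t => t.2 == (false, true)) s <= ~~ r)%N.
Proof.
elim: s r => [//|[l [p q]] s IH] r /= /and3P[rp pq /IH].
case: r rp; case: p pq; case: q => //= _ _ le.
all: by rewrite ?add1n ?add0n ?(leq_trans le).
Qed.

Lemma tvalid_le_last r (s : seq letter) c t : tvalid r s c -> t \in s ->
  t.2.2 ==> c.
Proof.
move=> vs /path.splitP ts; case: ts vs => s1 s2.
rewrite cat_rcons; elim: s1 r => [|[l [p q]] s1 IH] r /=.
  by case: t => l [p q] /and3P[_ _ /tvalid_trans].
by case/and3P=> _ _ /IH.
Qed.

(** Turns a list of letters in distinct variables into a type function on the variables. *)
Lemma seq_of_keys (K T : eqType) (d : K * T) (s : seq (K * T)) :
  uniq (unzip1 s) ->
  s = [seq (l, (nth d s (index l (unzip1 s))).2) | l <- unzip1 s].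
Proof.
move=> us; apply: (@eq_from_nth _ d) => [|i i_s]; first by rewrite !size_map.
have i_s' : (i < size (unzip1 s))%N by rewrite size_map.
rewrite (nth_map d.1) // index_uniq // [LHS]surjective_pairing; congr (_, _).
by rewrite /unzip1 (nth_map d).
Qed.

(** Row index 2 forces all types to be (2, 2), and column index 1 forces all to be (1, 1). For the
    entry (1, 2) the variables split by type, and [tvalid_count] allows at most one of type (1,
    2). *)
Lemma mty_surj r (s : seq letter) c : tvalid r s c ->
  perm_eq [seq t.1 | t <- s] (iota 0 m.+1) ->
  exists b, [/\ r = mrow b, c = mcol b & perm_eq s (tletters (mty b))].
Proof.
move=> vs ps.
(* Every variable occurs in [s], so the default type is never taken. *)
pose ty (i : 'I_m.+1) :=
  (nth (0%N, (false, false)) s (index (val i) (unzip1 s))).2.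
have sE : perm_eq s [seq (val i, ty i) | i <- enum 'I_m.+1].
  have us : uniq (unzip1 s) by rewrite (perm_uniq ps) iota_uniq.
  rewrite {1}(seq_of_keys (0%N, (false, false)) us).
  rewrite (perm_trans (perm_map _ ps)) // -val_enum_ord -map_comp.
  exact: perm_refl.
have ty_s i : (val i, ty i) \in s.
  by rewrite (perm_mem sE); apply/mapP; exists i; rewrite ?mem_enum.
have ty_le i : (ty i).1 ==> (ty i).2 by have /andP[] := tvalid_ge vs (ty_s i).
have ty_ge i : r ==> (ty i).1 by have /andP[] := tvalid_ge vs (ty_s i).
have ty_last i : (ty i).2 ==> c by have := tvalid_le_last vs (ty_s i).
suff [b [rE cE tE]] : exists b, [/\ r = mrow b, c = mcol b & ty =1 mty b].
  exists b; split=> //; apply: perm_trans sE _; rewrite perm_sym.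
  rewrite (eq_map (g := fun i => (val i, mty b i))) => [|i]; last first.
    by rewrite tE.
  exact/tletters_perm/mty_le.
have := tvalid_trans vs; case: r vs ty_ge => vs ty_ge;
  case: c vs ty_last => // vs ty_last _.
- exists (inl true); split=> // i; have := ty_ge i; have := ty_le i.
  by case: (ty i) => [] [] [].
- have [/existsP[i0 /eqP ty0]|/existsPn no] :=
      boolP [exists i, ty i == (false, true)]; last first.
    exists (inr (inl [set i | ty i == (false, false)]%SET)); split=> // i /=.
    rewrite inE; have := no i; have := ty_le i.
    by case: (ty i) => [] [] [].
  exists (inr (inr (i0, [set k | ty (lift i0 k) == (false, false)]%SET))).
  split=> // i /=; case: unliftP => [k|] -> //; rewrite inE.
  have := ty_le (lift i0 k); case E: (ty (lift i0 k)) => [[] []] //= _.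
  have := tvalid_count vs; rewrite (seq.permP sE) count_map count_enum.
  move=> /card_le1_eqP le1.
  have i0k : i0 = lift i0 k by apply: le1; apply/eqP.
  by have := neq_lift i0 k; rewrite -i0k eqxx.
exists (inl false); split=> // i; have := ty_last i; have := ty_le i.
by case: (ty i) => [] [] [].
Qed.

End MultilinearTypes.

(** * The codimensions *)

Section Codimension.
Variables (F : fieldType) (char0 : [pchar F] =i pred0) (m : nat).
Local Notation mtype :=
  (bool + ({set 'I_m.+1} + 'I_m.+1 * {set 'I_m}))%type.

Definition mword (b : mtype) : gpoly F :=
  tword (gX F) (mrow b) (tletters (mty b)) (mcol b).

(** With n = m + 1, the diagonal words, the words without entry x_(1,2) and those with one
    contribute 2, 2^n and n 2^(n-1). *)
Lemma card_mtype : #|{: mtype}| = ((m.+1 + 2) * 2 ^ m + 2)%N.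
Proof.
have cards k : #|{: {set 'I_k}}| = (2 ^ k)%N.
  by rewrite -cardsT -powersetT card_powerset cardsT card_ord.
rewrite !card_sum card_prod card_bool card_ord !cards expnS mulnDl.
by rewrite addnC [(2 * _ + _)%N]addnC.
Qed.

Lemma mword_indep (c : 'I_#|{: mtype}| -> F) :
  GId (UT2 F) (\sum_i c i *: mword (enum_val i)) -> forall i, c i = 0.
Proof.
move=> cId i.
(* The vectors of [tword_indep] are the unit row vectors: distinct indices have distinct data by
   [mty_inj], and the vanishing sum is the vector of coefficients itself. *)
have E : \sum_j c j *: delta_mx 0 j = 0 :> 'rV[F]_#|{: mtype}|.
  apply: (tword_indep char0 (r := fun j => mrow (enum_val j))
    (L := fun j => tletters (mty (enum_val j)))
    (c := fun j => mcol (enum_val j))) => [j _|j k _ _ rE cE p|a].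
  - split; first exact: tvalid_mty.
    exact: (letters_neq_nil (ltn0Sn m) (tletters_letters _)).
  - by rewrite (enum_val_inj (mty_inj rE cE p)).
  have aW := geval_whom a (@ut2_in_variety F).
  have E0 := cId a; rewrite (linf_sum (whom_linear aW)) in E0.
  rewrite -[RHS]E0; apply: eq_bigr => j _.
  by rewrite (linfZ (whom_linear aW)) geval_tword.
have := congr1 (fun A : 'rV_ _ => A 0 i) E; rewrite mxE summxE => <-.
rewrite (bigD1 i) //= !mxE !eqxx mulr1 big1 ?addr0 // => j /negPf ji.
by rewrite !mxE eq_sym ji andbF mulr0.
Qed.

(** Modulo the identities a valid word equals the basis word with the same ends and letters, and an
    invalid word is 0. *)
Lemma mword_span f : GP F m.+1 f ->
  exists c : 'I_#|{: mtype}| -> F,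
    GId (UT2 F) (f - \sum_i c i *: mword (enum_val i)).
Proof.
have IW := (GId_Tideal (@ut2_in_variety F)).1.
pose P : set (gpoly F) := [set f | exists c : 'I_#|{: mtype}| -> F,
  GId (UT2 F) (f - \sum_i c i *: mword (enum_val i))].
have subP : is_subspace P.
  split.
    exists (fun=> 0); rewrite big1 ?subrr => [|i _]; last by rewrite scale0r.
    exact: (wideal0 IW).
  move=> k a b [c cI] [d dI]; exists (fun i => k * c i + d i).
  have -> : k *: a + b - \sum_i (k * c i + d i) *: mword (enum_val i) =
      k *: (a - \sum_i c i *: mword (enum_val i))
      + (b - \sum_i d i *: mword (enum_val i)).
    rewrite scalerBr addrACA -opprD scaler_sumr -big_split; congr (_ - _).
    by apply: eq_bigr => i _; rewrite scalerDl scalerA.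
  by apply: (widealD IW) => //; apply: (widealZ IW).
apply: (@GP_min F m.+1 (ltn0Sn m) P) => // r L c Lp.
have [vL|/(tword_invalid (@gpoly_variety F) (gX F)) ->] := boolP (tvalid r L c);
  last exact: (subspace0 subP).
have [b [rE cE p]] := mty_surj vL Lp.
exists (fun i => (i == enum_rank b)%:R).
rewrite (bigD1 (enum_rank b)) //= eqxx scale1r enum_rankK big1 ?addr0.
  rewrite /mword -rE -cE; apply: (tword_perm_ut2) => //.
  by rewrite rE cE; apply: tvalid_mty.
by move=> i /negPf ->; rewrite scale0r.
Qed.

Lemma gc_ut2 : gc (UT2 F) m.+1 = ((m.+1 + 2) * 2 ^ m + 2)%N.
Proof.
have GPs : is_subspace (GP F m.+1) := lspan_subspace _.
have IW := (GId_Tideal (@ut2_in_variety F)).1.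
have GPw b : GP F m.+1 (mword b).
  by apply: GP_tword => //; apply: tletters_letters.
have B : quot_basis (GP F m.+1) (GP F m.+1 `&` GId (UT2 F)) #|{: mtype}|.
  exists (fun i => mword (enum_val i)); split=> // [c [_ cI]|f fGP].
    exact: mword_indep.
  have [c cI] := mword_span fGP; exists c; split=> //.
  (* The quotient is by the identities inside [GP], so the difference must also be placed in
     [GP]. *)
  rewrite addrC -scaleN1r; apply: (subspaceP GPs) => //.
  apply: (big_rec (fun y => GP F m.+1 y)) => [|i y _ Py].
    exact: (subspace0 GPs).
  exact: (subspaceP GPs).
(* [quot_dim] selects some dimension; [quot_basis_uniq] identifies it with the size of the basis
   just exhibited. *)
rewrite -card_mtype; apply: (quot_basis_uniq _ _ _ B).
- by split; [exact: (subspace0 GPs) | exact: (wideal0 IW)].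
- move=> k u v [uP uI] [vP vI]; split; first exact: (subspaceP GPs).
  by apply: (widealD IW) => //; apply: (widealZ IW).
exact: (xgetPex 0%N (ex_intro _ _ B)).
Qed.

End Codimension.

Unset Implicit Arguments.

Theorem theorem3p2 (F : fieldType) (char0 : [pchar F] =i pred0) :
  GId (UT2 F) =
    Tideal_gen [set wcomm (gX F 0) (gX F 1)
                    - wcommW (wcomm (gX F 0) (gX F 1)) (e22 F)]
  /\ forall n : nat, (0 < n)%N ->
       gc (UT2 F) n = ((n + 2) * 2 ^ (n - 1) + 2)%N.
Proof.
split=> [|[//|m] _]; first exact: GId_ut2.
by rewrite subn1; apply: gc_ut2.
Qed.
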